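(* Let $n \geq 3$ and $1 \leq k < n$. There exist compact convex sets $K, L \subseteq \mathbb{R}^n$ such that, for every $k$-dimensional linear subspace $\xi$ of $\mathbb{R}^n$, the orthogonal projection $L_\xi$ contains a translate of the orthogonal projection $K_\xi$, while $V_m(K) > V_m(L)$ for all integers $m$ with $k < m \leq n$.
   Context: For a linear subspace $\xi$ of $\mathbb{R}^n$ and a set $K\subseteq\mathbb{R}^n$, $K_\xi$ denotes the orthogonal projection of $K$ onto $\xi$. For $0\le m\le n$, $V_m(K)$ denotes the $m$-th intrinsic volume of the compact convex set $K$, normalized so that $V_m$ agrees with $m$-dimensional volume on $m$-dimensional convex sets; up to a positive constant depending only on $n$ and $m$, $V_m(K)$ is the mean (over the rotation-invariant probability measure on $m$-dimensional linear subspaces) of the $m$-dimensional volume of the orthogonal projections of $K$ onto $m$-dimensional subspaces. In particular $V_n$ is $n$-dimensional volume. Compact convex sets are nonempty. *)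

(* Defs.v *)
From HB Require Import structures.
From mathcomp Require Import all_boot all_order all_algebra.
From mathcomp Require Import all_classical all_reals all_analysis.
Import Order.TTheory GRing.Theory Num.Theory.
Import numFieldNormedType.Exports.

Set Implicit Arguments.
Unset Strict Implicit.
Unset Printing Implicit Defensive.

Local Open Scope classical_set_scope.
Local Open Scope ring_scope.

(* Points of R^n are row vectors, so matrices act on the right. *)

(* The n-fold iterated product of the one-dimensional Lebesgue measure. It is
   defined on arbitrary sets, but only meant for Borel sets, where it is
   Lebesgue measure by Tonelli's theorem; it is only applied below to compact
   sets. In dimension 0 it is the counting measure of the one-point space. *)
Fixpoint volume (R : realType) (n : nat) : set 'rV[R]_n -> \bar R :=
  match n with
  | 0 => fun A => ((\1_A (0 : 'rV[R]_0) : R)%:E)%E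
  | n'.+1 => fun A =>
      (\int[@lebesgue_measure R]_x
         volume [set y : 'rV[R]_n' |
                   A (row_mx (x%:M : 'M[R]_1) y : 'rV[R]_(1 + n'))])%E
  end.

Definition unit_ball (R : realType) (n : nat) : set 'rV[R]_n :=
  [set x | \sum_(i < n) x 0 i ^+ 2 <= 1].

Definition compact_convex (R : realType) (n : nat) (K : set 'rV[R]_n) : Prop :=
  [/\ K !=set0, compact K & convex_set K].

(* A linear subspace of R^n is represented by the matrix of the orthogonal
   projection onto it, that is, by the unique symmetric idempotent matrix whose
   row space it is (see grassmannian_rowspace and grassmannian_orthogonal). *)
Definition grassmannian (R : realType) (n m : nat) : set 'M[R]_n :=
  [set xi | [/\ xi^T = xi, xi *m xi = xi & \rank xi = m]].

Definition shadow (R : realType) (n : nat) (K : set 'rV[R]_n) (xi : 'M[R]_n) :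
    set 'rV[R]_n :=
  [set x *m xi | x in K].

Definition contains_translate (R : realType) (n : nat) (B A : set 'rV[R]_n) :
    Prop :=
  exists v : 'rV[R]_n, [set x + v | x in A] `<=` B.

(* The rows of b form an orthonormal basis of the subspace xi. *)
Definition orthonormal_frame (R : realType) (n m : nat) (xi : 'M[R]_n) :
    set 'M[R]_(m, n) :=
  [set b | b *m b^T = 1%:M /\ b^T *m b = xi].

(* The m-dimensional volume of a subset A of the m-dimensional subspace xi,
   measured in the coordinates of an orthonormal basis of xi; it does not depend
   on the choice of that basis. *)
Definition subspace_volume (R : realType) (n m : nat) (xi : 'M[R]_n)
    (A : set 'rV[R]_n) : \bar R :=
  volume [set y *m (get (@orthonormal_frame R n m xi))^T | y in A].

Definition borel_mx (R : realType) (n : nat) :=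
  g_sigma_algebraType (@open 'M[R]_n).

(* mu is carried by the m-dimensional subspaces and invariant under rotations:
   for a rotation Q, the map x |-> x *m Q takes the subspace with projection
   matrix xi to the one with projection matrix Q^T *m xi *m Q. For m <= n there
   is exactly one such mu. *)
Definition rotation_invariant (R : realType) (n m : nat)
    (mu : probability (borel_mx R n) R) : Prop :=
  mu (@grassmannian R n m) = 1%E /\
  forall (Q : 'M[R]_n) (B : set (borel_mx R n)),
    Q^T *m Q = 1%:M -> \det Q = 1 -> measurable B ->
    mu [set xi : 'M[R]_n | B (Q^T *m xi *m Q)] = mu B.

(* Kubota's formula; the flag coefficient in front of the mean makes V_m agree
   with the m-dimensional volume on m-dimensional convex sets. *)
Definition flag_coefficient (R : realType) (n m : nat) : R :=
  let kappa j := fine (volume (@unit_ball R j)) in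
  'C(n, m)%:R * kappa n / (kappa m * kappa (n - m)%N).

Definition intrinsic_volume (R : realType) (n m : nat)
    (mu : probability (borel_mx R n) R) (K : set 'rV[R]_n) : \bar R :=
  ((flag_coefficient R n m)%:E *
   \int[mu]_(xi in @grassmannian R n m)
      subspace_volume m xi (shadow K xi))%E.

Lemma mulmx_trmx_eq0 (R : realType) (p n : nat) (A : 'M[R]_(p, n)) :
  A *m A^T = 0 -> A = 0.
Proof.
move=> /matrixP A0; apply/matrixP => i j; rewrite mxE.
have S0 : \sum_k A i k ^+ 2 = 0.
  have := A0 i i; rewrite !mxE => S0; rewrite -[RHS]S0.
  by apply: eq_bigr => k _; rewrite mxE expr2.
apply/eqP; rewrite -sqrf_eq0; apply/eqP.
by apply: (psumr_eq0P _ S0) => // k _; exact: sqr_ge0.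
Qed.

Lemma grassmannian_orthogonal (R : realType) (n m : nat) (xi : 'M[R]_n)
    (x y : 'rV[R]_n) :
  grassmannian m xi -> (y <= xi)%MS -> (x - x *m xi) *m y^T = 0.
Proof.
move=> [xiT xiK _] /submxP[z ->].
by rewrite trmx_mul xiT mulmxA mulmxBl -(mulmxA x) xiK subrr mul0mx.
Qed.

Lemma grassmannian_rowspace (R : realType) (n : nat) (A : 'M[R]_n) :
  exists! xi : 'M[R]_n, grassmannian (\rank A) xi /\ (xi :=: A)%MS.
Proof.
move: (row_base A) (row_base_free A) (eq_row_base A) => b bfree bA.
set G := b *m b^T.
have GT : G^T = G by rewrite trmx_mul trmxK.
have Gu : G \in unitmx.
  rewrite -row_free_unit -kermx_eq0; apply/eqP.
  set N := kermx G; have NG : N *m G = 0 by exact: mulmx_ker.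
  have Nb : N *m b = 0.
    by apply: mulmx_trmx_eq0; rewrite trmx_mul mulmxA -(mulmxA N) NG mul0mx.
  by apply: (row_free_inj bfree); rewrite Nb mul0mx.
pose xi := b^T *m invmx G *m b.
have bxi : b *m xi = b by rewrite /xi !mulmxA mulmxV // mul1mx.
have xiA : (xi :=: A)%MS.
  apply: eqmx_trans bA; apply/eqmxP/andP.
  by split; [exact: submxMl | apply/submxP; exists b].
have xiT : xi^T = xi by rewrite /xi !trmx_mul trmxK trmx_inv GT mulmxA.
have xiK : xi *m xi = xi by rewrite {1}/xi -mulmxA bxi.
exists xi; split; first by split=> //; split=> //; rewrite xiA.
move=> xi' [[xiT' xiK' _] xiA'].
have e1 : xi *m xi' = xi.
  have /submxP[D ->] : (xi <= xi')%MS by rewrite xiA xiA'.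
  by rewrite -mulmxA xiK'.
have e2 : xi' *m xi = xi'.
  have /submxP[D ->] : (xi' <= xi)%MS by rewrite xiA xiA'.
  by rewrite -mulmxA xiK.
by rewrite -xiT -e1 trmx_mul xiT xiT' e2.
Qed.

(* Main.v *)
(* Write d = k + 1 and let S be the standard simplex of R^d. If P is a linear map of
   rank at most k, an affine dependence between the d + 1 vertices of P(S) shows
   that P(S) contains a translate of -P(S)/k, hence one of P((1 - t) S - (t/k) S).
   On the other hand (1 - t) S - (t/k) S has a larger volume than S for small
   t > 0, its volume being (1 - d t + d^2 t/k + O(t^2)) vol S and d > k. So
   (1 - t) S - (t/k) S and S settle the case n = d.
   In general take the products K and L of these two sets with a small cube
   [0, e]^(n - d). For m = p + d, the m-dimensional volumes of the shadows of K and
   L have leading terms of order e^p as e -> 0, whose ratio is that of the volumes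
   of the two d-dimensional factors, up to an error o(e^p) that is uniform in the
   subspace; the mean over the Grassmannian of the leading term is positive by
   rotation invariance. The change of variables formula for the iterated integral
   defining volume is only needed on compact sets, where the volume of the sections
   is upper semicontinuous and hence measurable. *)
Require Import Defs.
From HB Require Import structures.
From mathcomp Require Import all_boot all_order all_algebra fingroup perm.
From mathcomp Require Import all_classical all_reals all_analysis.
From mathcomp Require Import measurable_realfun simple_functions ring lra zify.
Import Order.TTheory GRing.Theory Num.Theory.
Import numFieldNormedType.Exports.

Set Implicit Arguments.
Unset Strict Implicit.
Unset Printing Implicit Defensive.

Local Open Scope classical_set_scope.
Local Open Scope ring_scope.

(** The set (1 - t) S - (t/k) S is encoded as [cross k.+1 (1 - t) (t / k%:R)]: bounding separately
    the sums of the positive and of the negative parts of the coordinates makes its sections by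
    hyperplanes x_1 = const sets of the same kind, which suits an induction on the dimension. The
    containment of shadows survives the product with the cube because only the first d coordinates
    of a point are modified, and the restriction to them of a projection of rank k still has rank at
    most k.

    The volume of a shadow is computed in a frame picked by choice, and no measurability in the
    subspace is established. Two means are therefore compared through a pointwise bound c f <= g +
    M, with c > 1 and M constant, which passes to lower integrals. It yields a strict inequality
    only if M = eta e^p is small against the mean of f, itself at least delta e^p with delta
    independent of e. So delta is extracted from a set of subspaces of positive measure on which a
    fixed Jacobian is bounded below, and eta is chosen after it. *)

Local Notation image_mx A N := [set x *m N | x in A].

(** * Integration *)

Section lower_integral.
Local Open Scope ereal_scope.
Context d (T : measurableType d) (R : realType).
Import HBNNSimple.

(* The integral of an arbitrary nonnegative function is its lower integral, so that
   the next two lemmas need no measurability of f and g. *)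
Lemma le_lower_integral (mu : {measure set T -> \bar R}) (D : set T)
    (f g : T -> \bar R) :
  (forall x, D x -> 0 <= f x) -> (forall x, D x -> f x <= g x) ->
  \int[mu]_(x in D) f x <= \int[mu]_(x in D) g x.
Proof.
move=> f0 fg; have g0 x : D x -> 0 <= g x.
  by move=> Dx; exact: le_trans (f0 _ Dx) (fg _ Dx).
rewrite !ge0_integralE //; apply: ereal_sup_le => _ [h hf <-].
exists h => // x; apply: le_trans (hf x) _.
by rewrite /patch; case: ifPn => //; rewrite inE => /fg.
Qed.

Lemma lower_integral_affine (mu : probability T R) (D : set T)
    (f g : T -> \bar R) (c M : R) : (0 < c)%R -> (0 <= M)%R ->
  (forall x, D x -> 0 <= f x) -> (forall x, D x -> 0 <= g x) ->
  (forall x, D x -> c%:E * f x <= g x + M%:E) ->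
  c%:E * \int[mu]_(x in D) f x <= \int[mu]_(x in D) g x + M%:E.
Proof.
move=> c0 M0 f0 g0 fg.
rewrite -lee_pdivlMl // {1}ge0_integralE //; apply: ge_ereal_sup => _ [h hf <-].
rewrite lee_pdivlMl // -integralT_nnsfun.
(* The truncation of c h - M at 0 is measurable, lies below g on D and vanishes off D, where h = 0.
   Since c h <= k + M everywhere and the total mass is 1, integrating costs exactly M. *)
pose k x : R := (Num.max (c * h x - M) 0)%R.
have mk : measurable_fun setT (fun x => (k x)%:E).
  apply/measurable_EFinP; apply: measurable_maxr => //.
  by apply: measurable_funB => //; apply: measurable_funM.
have k0 x : 0 <= (k x)%:E by rewrite lee_fin le_max lexx orbT.
have hk : \int[mu]_x (k x)%:E <= \int[mu]_(x in D) g x.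
  rewrite (integral_mkcond D); apply: le_lower_integral => // x _.
  have := hf x; rewrite /patch; case: ifPn => [|_].
    rewrite inE => Dx hfx; rewrite /k EFin_max ge_max g0 // andbT.
    rewrite EFinB leeBlDr // (le_trans _ (fg x Dx)) // EFinM.
    by rewrite lee_pmul2l // ltry.
  rewrite lee_fin => hx; rewrite lee_fin /k.
  have -> : h x = 0%R by apply/eqP; rewrite eq_le hx /=.
  by rewrite mulr0 sub0r ge_max lexx andbT oppr_le0.
apply: (@le_trans _ _ (\int[mu]_x (k x)%:E + M%:E)); last exact: leeD.
have -> : M%:E = \int[mu]_x (cst M%:E) x.
  rewrite integral_cst // [X in _ * X](_ : _ = 1) ?mule1 //.
  exact: probability_setT.
rewrite -ge0_integralZl_EFin //; last 3 first.
- by move=> x _; rewrite lee_fin.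
- exact/measurable_EFinP.
- exact: ltW.
rewrite -ge0_integralD //=.
apply: le_lower_integral => x _; first by rewrite mule_ge0 // lee_fin // ltW.
by rewrite -EFinM -EFinD lee_fin -lerBlDr le_max lexx.
Qed.

End lower_integral.

(** * Affine substitution in one-dimensional integrals *)

Section affine_substitution.
Context {R : realType}.
Local Notation mu := (@lebesgue_measure R).

Let aff (u b : R) (x : measurableTypeR R) : measurableTypeR R :=
  (x : R) * u + b.

Let measurable_aff u b : measurable_fun setT (aff u b).
Proof.
by apply: measurable_funD => //; apply: measurable_funM.
Qed.

(** The pushforward rescaled by |u| gives half-open intervals their length, so it is Lebesgue
    measure by uniqueness. For u < 0 the preimage of such an interval is closed at the other end. *)
Lemma lebesgue_measure_affine (u b : R) (A : set R) : u != 0 -> measurable A ->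
  mu (aff u b @^-1` A) = (`|u|^-1%:E * mu A)%E.
Proof.
move=> u0 mA.
have u1 : 0 < `|u| by rewrite normr_gt0.
pose nu := mscale (NngNum (ltW u1)) (pushforward mu (aff u b)).
have nuE : mu A = nu (measurable_aff u b) A.
  apply: lebesgue_measure_unique => // _ [[x y]] _ <- /=.
  rewrite /nu /mscale /pushforward /=.
  have [ug|ul] : 0 < u \/ u < 0 by move/lt_total/orP: u0 => []; [right|left].
    rewrite [X in (_ * mu X)%E](_ : _ = `](x - b) / u, (y - b) / u]%classic); last first.
      apply/seteqP; split => z /=; rewrite !in_itv /= ltr_pdivrMr // ler_pdivlMr // /aff.
        by move=> /andP[? ?]; apply/andP; split; lra.
      by move=> /andP[? ?]; apply/andP; split; lra.
    rewrite !lebesgue_measure_itv /= !lte_fin ltr_pM2r ?invr_gt0 // ltrD2r.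
    case: ifPn => // _; last by rewrite mule0.
    by rewrite -!EFinB -EFinM gtr0_norm //; congr EFin; field.
  rewrite [X in (_ * mu X)%E](_ : _ = `[(y - b) / u, (x - b) / u[%classic); last first.
    apply/seteqP; split => z /=; rewrite !in_itv /= ltr_ndivlMr // ler_ndivrMr // /aff.
      by move=> /andP[? ?]; apply/andP; split; lra.
    by move=> /andP[? ?]; apply/andP; split; lra.
  rewrite !lebesgue_measure_itv /= !lte_fin ltr_nM2r ?invr_lt0 // ltrD2r.
  case: ifPn => // _; last by rewrite mule0.
  by rewrite -!EFinB -EFinM ltr0_norm //; congr EFin; field.
rewrite nuE /nu /mscale /= muleA -EFinM mulVf ?mul1e //.
by rewrite gt_eqF.
Qed.

Lemma ge0_integral_affine (u b : R) (f : R -> \bar R) : u != 0 ->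
  measurable_fun setT f -> (forall x, 0 <= f x)%E ->
  (\int[mu]_x f (x * u + b)%R = `|u|^-1%:E * \int[mu]_x f x)%E.
Proof.
move=> u0 mf f0.
have v0 : 0 <= `|u|^-1 by rewrite invr_ge0.
have := @ge0_integral_pushforward _ _ _ _ _ _ (measurable_aff u b) mu setT f
  measurableT mf (fun x _ => f0 x).
rewrite preimage_setT /comp /aff => <-.
rewrite -(ge0_integral_mscale mu measurableT (NngNum v0) mf) //.
apply: eq_measure_integral => /=; first exact: measurable_aff.
move=> mf1 A mA _; exact: lebesgue_measure_affine.
Qed.

End affine_substitution.

(** * Compact sets of matrices *)

Section matrix_topology.
Context {R : realType}.

Lemma mx_continuous (T : topologicalType) (p q : nat) (f : T -> 'M[R]_(p, q)) :
  (forall i j, continuous (fun x => f x i j)) -> continuous f.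
Proof.
move=> cf x A [P Pn PA].
have : \forall y \near x, forall i j, P i j (f y i j).
  by apply: filter_forall => i; apply: filter_forall => j; exact: (cf i j x _ (Pn i j)).
by apply: filterS => y Py; exact: PA.
Qed.

Lemma continuous_add (T : topologicalType) (f g : T -> R) :
  continuous f -> continuous g -> continuous (fun x => f x + g x).
Proof. by move=> cf cg x; apply: cvgD; [exact: cf | exact: cg]. Qed.

Lemma continuous_mul (T : topologicalType) (f g : T -> R) :
  continuous f -> continuous g -> continuous (fun x => f x * g x).
Proof. by move=> cf cg x; apply: cvgM; [exact: cf | exact: cg]. Qed.

Lemma continuous_sub (T : topologicalType) (f g : T -> R) :
  continuous f -> continuous g -> continuous (fun x => f x - g x).
Proof. by move=> cf cg x; apply: cvgB; [exact: cf | exact: cg]. Qed.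

Lemma continuous_sum (T : topologicalType) (I : Type) (r : seq I) (P : pred I)
    (f : I -> T -> R) :
  (forall i, continuous (f i)) -> continuous (fun x => \sum_(i <- r | P i) f i x).
Proof.
move=> cf x; elim: r => [|i r IH].
  by under eq_fun do rewrite big_nil; rewrite ?big_nil; exact: cvg_cst.
under eq_fun do rewrite big_cons; rewrite ?big_cons.
by case: (P i) => //; apply: cvgD => //; exact: cf.
Qed.

Lemma continuous_prod (T : topologicalType) (I : Type) (r : seq I) (P : pred I)
    (f : I -> T -> R) :
  (forall i, continuous (f i)) -> continuous (fun x => \prod_(i <- r | P i) f i x).
Proof.
move=> cf x; elim: r => [|i r IH].
  by under eq_fun do rewrite big_nil; rewrite ?big_nil; exact: cvg_cst.
under eq_fun do rewrite big_cons; rewrite ?big_cons.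
by case: (P i) => //; apply: cvgM => //; exact: cf.
Qed.

Lemma continuous_coord (T : topologicalType) (p q : nat) (f : T -> 'M[R]_(p, q))
    i j : continuous f -> continuous (fun x => f x i j).
Proof.
move=> cf x; apply: (@continuous_comp _ _ _ f (fun M : 'M[R]_(p, q) => M i j)).
  exact: cf.
exact: coord_continuous.
Qed.

Lemma continuous_mulmx (T : topologicalType) (p q r : nat)
    (f : T -> 'M[R]_(p, q)) (g : T -> 'M[R]_(q, r)) :
  continuous f -> continuous g -> continuous (fun x => f x *m g x).
Proof.
move=> cf cg; apply: mx_continuous => i j.
under eq_fun do rewrite mxE.
by apply: continuous_sum => k x; apply: cvgM; exact: continuous_coord.
Qed.

Lemma continuous_det (T : topologicalType) (p : nat) (f : T -> 'M[R]_p) :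
  continuous f -> continuous (fun x => \det (f x)).
Proof.
move=> cf; rewrite /determinant; apply: continuous_sum => s x.
apply: cvgM; first exact: cvg_cst.
by apply: continuous_prod => i y; exact: continuous_coord.
Qed.

Lemma near_coord (p q : nat) (M : 'M[R]_(p, q)) (e : R) : 0 < e ->
  \forall N \near M, forall i j, `|M i j - (N : 'M[R]_(p, q)) i j| < e.
Proof.
move=> e0.
pose P i j (N : 'M[R]_(p, q)) := `|M i j - N i j| < e.
apply: (@filter_forall _ _ (fun i => [set N | forall j, P i j N]) (nbhs M)) => i.
apply: (@filter_forall _ _ (fun j => P i j) (nbhs M)) => j.
by move/cvgrPdist_lt : (@coord_continuous R p q i j M) => /(_ _ e0).
Qed.

Lemma compact_coord_bound (p q : nat) (A : set 'M[R]_(p, q)) : compact A ->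
  exists2 M : R, 0 < M & forall x, A x -> forall i j, `|x i j| <= M.
Proof.
move=> /compact_bounded [M [_ AM]].
exists (`|M| + 1); first by rewrite ltr_wpDl.
move=> x Ax i j; apply: le_trans (AM (`|M| + 1) _ x Ax).
  rewrite [leRHS]/Num.norm /= mx_normrE.
  by apply/bigmax_geP; right; exists (i, j).
by rewrite ltr_pwDr // ler_norm.
Qed.

Lemma compact_box (p : nat) (a b : 'I_p -> R) :
  compact [set x : 'rV[R]_p | forall i, a i <= x 0 i <= b i].
Proof.
have -> : [set x : 'rV[R]_p | forall i, a i <= x 0 i <= b i] =
    [set x | forall i, `[a i, b i]%classic (x ord0 i)].
  by apply/seteqP; split => x /= xab i; have := xab i; rewrite /= in_itv.
by apply: (@rV_compact _ _ (fun i => `[a i, b i]%classic)) => i; exact: segment_compact.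
Qed.

Lemma compact_mx_ball (p q : nat) (M : R) :
  compact [set x : 'M[R]_(p, q) | forall i j, `|x i j| <= M].
Proof.
pose B := [set x : 'rV[R]_(p * q) | forall i, - M <= x 0 i <= M].
have -> : [set x : 'M[R]_(p, q) | forall i j, `|x i j| <= M] = vec_mx @` B.
  apply/seteqP; split => [x xM|_ [x xB <-] i j]; last first.
    by rewrite mxE ler_norml; exact: xB.
  exists (mxvec x); last exact: mxvecK.
  by move=> k; case/mxvec_indexP: k => i j; rewrite mxvecE -ler_norml; exact: xM.
apply: continuous_compact; last exact: compact_box.
apply: continuous_subspaceT; apply: mx_continuous => i j.
by under eq_fun do rewrite mxE; exact: coord_continuous.
Qed.

Lemma compact_image_mulmx (p q : nat) (A : set 'rV[R]_p) (N : 'M[R]_(p, q)) :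
  compact A -> compact [set x *m N | x in A].
Proof.
move=> cA; apply: continuous_compact cA.
apply: continuous_subspaceT; apply: (@continuous_mulmx _ _ _ _ id (fun=> N)).
  by move=> x; exact: cvg_id.
exact: cst_continuous.
Qed.

(** * Sections and thickenings of compact sets *)

Definition section_at (p q : nat) (x : 'rV[R]_p) (A : set 'rV[R]_(p + q)) :
  set 'rV[R]_q := [set y | A (row_mx x y)].

(** The closed neighbourhood of radius rho in the sup norm; the non-strict inequality keeps
    thickenings of compact sets compact. *)
Definition thicken (p : nat) (rho : R) (A : set 'rV[R]_p) : set 'rV[R]_p :=
  [set y | exists2 x, A x & forall i, `|x 0 i - y 0 i| <= rho].

Lemma compact_section (p q : nat) (x : 'rV[R]_p) (A : set 'rV[R]_(p + q)) :
  compact A -> compact (section_at x A).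
Proof.
move=> cA; have [M M0 AM] := compact_coord_bound cA.
have cB := @compact_box q (fun=> - M) (fun=> M).
apply: subclosed_compact _ cB _; last first.
  move=> y Axy i; have := AM _ Axy 0 (rshift p i).
  by rewrite row_mxEr ler_norml.
have -> : section_at x A = row_mx x @^-1` A by [].
apply: preimage_closed; last exact: compact_closed (@norm_hausdorff _ _) cA.
move=> y _; apply: mx_continuous => i j.
case: (split_ordP j) => k ->.
  by under eq_fun do rewrite row_mxEl; exact: cst_continuous.
by under eq_fun do rewrite row_mxEr; exact: coord_continuous.
Qed.

Lemma subset_thicken (p : nat) (rho : R) (A : set 'rV[R]_p) :
  0 <= rho -> A `<=` thicken rho A.
Proof. by move=> rho0 x Ax; exists x => // i; rewrite subrr normr0. Qed.

Lemma thickenS (p : nat) (rho rho' : R) (A : set 'rV[R]_p) :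
  rho <= rho' -> thicken rho A `<=` thicken rho' A.
Proof. by move=> rr y [x Ax xy]; exists x => // i; exact: le_trans (xy i) rr. Qed.

Lemma thicken_thicken (p : nat) (rho rho' : R) (A : set 'rV[R]_p) :
  thicken rho (thicken rho' A) `<=` thicken (rho + rho') A.
Proof.
move=> y [x [z Az zx] xy]; exists z => // i.
by rewrite (le_trans (ler_distD (x 0 i) _ _)) // addrC lerD.
Qed.

Lemma compact_thicken (p : nat) (rho : R) (A : set 'rV[R]_p) :
  compact A -> compact (thicken rho A).
Proof.
move=> cA; have cB := @compact_box p (fun=> - rho) (fun=> rho).
have -> : thicken rho A = (fun z => z.1 + z.2) @`
    (A `*` [set x : 'rV[R]_p | forall i, - rho <= x 0 i <= rho]).
  apply/seteqP; split => [y [x Ax xy]|_ [[x y] [/= Ax yr] <-]].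
    exists (x, y - x) => /=; last by rewrite addrC subrK.
    by split => // i; rewrite !mxE -ler_norml distrC.
  by exists x => // i; rewrite !mxE opprD addNKr normrN ler_norml.
apply: continuous_compact; last exact: compact_setX.
apply: continuous_subspaceT; apply: mx_continuous => i j.
under eq_fun do rewrite mxE.
by apply: continuous_add; apply: continuous_coord => x; [exact: cvg_fst | exact: cvg_snd].
Qed.

(** Upper hemicontinuity of the sections. A point of A over x has its second component in the
    section at x, so nearby points are within rho of it; a point of A not over x keeps a positive
    distance from the fiber. Compactness of A makes the radius d uniform. *)
Lemma section_thicken (p q : nat) (A : set 'rV[R]_(p + q)) (x : 'rV[R]_p)
    (rho : R) : compact A -> 0 < rho ->
  \forall d \near (0:R)^'+, forall x' : 'rV[R]_p, (forall i, `|x 0 i - x' 0 i| <= d) ->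
    section_at x' A `<=` thicken rho (section_at x A).
Proof.
move=> cA rho0.
pose P (d : R) (a : 'rV[R]_(p + q)) :=
  (forall i, `|x 0 i - lsubmx a 0 i| <= d) ->
  thicken rho (section_at x A) (rsubmx a).
have : \forall d \near (0:R)^'+, A `<=` P d.
  move/compact_near_coveringP : cA; apply => a Aa.
  have [xa|xa] := eqVneq (lsubmx a) x.
    exists ([set a' : 'rV[R]_(p + q) | forall i j, `|a i j - a' i j| < rho], setT) => /=.
      by split; [exact: near_coord | exact: filterT].
    move=> [a' d] /= [aa' _] _; exists (rsubmx a).
      by rewrite /section_at /= -xa hsubmxK.
    by move=> i; rewrite !mxE; exact/ltW/aa'.
  have [i xai] : exists i, lsubmx a 0 i != x 0 i.
    apply/existsP; apply: contraNT xa; rewrite negb_exists => /forallP xa.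
    by apply/eqP/rowP => i; apply/eqP; move: (xa i); rewrite negbK.
  pose e := `|x 0 i - lsubmx a 0 i| / 2.
  have e0 : 0 < e by rewrite divr_gt0 // normr_gt0 subr_eq0 eq_sym.
  exists ([set a' : 'rV[R]_(p + q) | forall i j, `|a i j - a' i j| < e], [set d | d < e]) => /=.
    by split; [exact: near_coord | exact: nbhs_right_lt].
  move=> [a' d] /= [aa' de] /(_ i) xa'.
  exfalso; have := aa' 0 (lshift q i); rewrite !mxE in xa' *.
  have := ler_distD (a' 0 (lshift q i)) (x 0 i) (a 0 (lshift q i)).
  rewrite [X in _ <= _ + X]distrC.
  have : `|x 0 i - a 0 (lshift q i)| = 2 * e.
    by rewrite /e mxE mulrCA divff ?mulr1.
  move=> ->; move: xa' de; set u := `|_ - _|; set v := `|_ - _|; lra.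
apply: filterS => d AP x' xx' y Axy.
have := AP _ Axy; rewrite /P row_mxKl row_mxKr; exact.
Qed.

End matrix_topology.

(** * Volume of compact sets *)

Section volume_theory.
Context {R : realType}.
Local Notation mu := (@lebesgue_measure R).

Lemma volumeS_section (p : nat) (A : set 'rV[R]_p.+1) :
  volume A = (\int[mu]_x volume (@section_at R 1 p x%:M A))%E.
Proof. by []. Qed.

Lemma volume0_in (A : set 'rV[R]_0) : A 0 -> volume A = 1%E.
Proof. by move=> A0; rewrite /= indicE mem_set. Qed.

Lemma volume0_notin (A : set 'rV[R]_0) : ~ A 0 -> volume A = 0%E.
Proof. by move=> A0; rewrite /= indicE memNset. Qed.

Lemma volume_ge0 (p : nat) (A : set 'rV[R]_p) : (0 <= volume A)%E.
Proof.
elim: p A => [|p IH] A; first by rewrite /= lee_fin.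
by rewrite volumeS_section; apply: integral_ge0 => x _; exact: IH.
Qed.

Lemma le_volume (p : nat) (A B : set 'rV[R]_p) :
  A `<=` B -> (volume A <= volume B)%E.
Proof.
elim: p A B => [|p IH] A B AB. 
  have [A0|A0] := pselect (A 0); first by rewrite !volume0_in //; exact: AB.
  by rewrite volume0_notin // volume_ge0.
rewrite !volumeS_section; apply: le_lower_integral => x _; first exact: volume_ge0.
by apply: IH => y; exact: AB.
Qed.

Lemma volume_set0 (p : nat) : volume (set0 : set 'rV[R]_p) = 0%E.
Proof.
elim: p => [|p IH]; first by rewrite volume0_notin.
by rewrite volumeS_section integral0_eq.
Qed.

Lemma row_mx1E (p : nat) (x : R) (y : 'rV[R]_p) (i : 'I_(1 + p)) :
  row_mx (x%:M : 'M[R]_1) y 0 i = if unlift 0 i is Some j then y 0 j else x.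
Proof.
case: unliftP => [j ->|->].
  have -> : lift 0 j = rshift 1 j by exact: val_inj.
  exact: row_mxEr.
have -> : (0 : 'I_(1 + p)) = lshift p 0 by exact: val_inj.
by rewrite row_mxEl mxE.
Qed.

Lemma row_mx1_0 (p : nat) (x : R) (y : 'rV[R]_p) :
  row_mx (x%:M : 'M[R]_1) y 0 0 = x.
Proof. by rewrite row_mx1E unlift_none. Qed.

Lemma row_mx1_lift (p : nat) (x : R) (y : 'rV[R]_p) (i : 'I_p) :
  row_mx (x%:M : 'M[R]_1) y 0 (lift 0 i) = y 0 i.
Proof. by rewrite row_mx1E liftK. Qed.

Lemma integral_cst_itv (a b c : R) : a <= b ->
  (\int[mu]_(x in `[a, b]) (cst c%:E) x = ((b - a) * c)%:E)%E.
Proof.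
move=> ab; rewrite integral_cst //= lebesgue_measure_itv /= lte_fin.
case: ltgtP ab => // [ab _|-> _]; first by rewrite -EFinB -EFinM mulrC.
by rewrite mule0 subrr mul0r.
Qed.

Lemma volume_box (p : nat) (a b : 'I_p -> R) : (forall i, a i <= b i) ->
  volume [set x : 'rV[R]_p | forall i, a i <= x 0 i <= b i] =
  (\prod_i (b i - a i))%:E.
Proof.
elim: p a b => [|p IH] a b ab.
  by rewrite volume0_in ?big_ord0 //= => -[].
rewrite volumeS_section big_ord_recl -integral_cst_itv // [RHS]integral_mkcond.
apply: eq_integral => x _; rewrite /patch mem_setE in_itv /=.
case: ifPn => xab; last first.
  rewrite (_ : section_at _ _ = set0) ?volume_set0 //.
  apply/seteqP; split => // y /= /(_ 0).
  by rewrite row_mx1_0; apply/negP.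
rewrite -IH //; congr volume; apply/seteqP; split => y /= yab i.
  by have := yab (lift 0 i); rewrite row_mx1_lift.
by case: (unliftP 0 i) => [j ->|->]; rewrite ?row_mx1_lift ?row_mx1_0.
Qed.

Lemma volume_compact_lty (p : nat) (A : set 'rV[R]_p) : compact A ->
  (volume A < +oo)%E.
Proof.
move=> /compact_coord_bound [M M0 AM].
have AB : A `<=` [set x | forall i, (fun=> - M) i <= x 0 i <= (fun=> M) i].
  by move=> x Ax i; rewrite -ler_norml; exact: AM.
apply: le_lt_trans (le_volume AB) _.
by rewrite volume_box ?ltry // => i; lra.
Qed.

(** Semicontinuity of volume in dimension q is a hypothesis here so that the lemma can serve inside
    the induction proving [volume_usc] as well as after it. *)
Lemma section_volume_usc_of (p q : nat) (A : set 'rV[R]_(p + q)) (x : 'rV[R]_p)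
    (c : \bar R) :
  (forall (B : set 'rV[R]_q) (c : \bar R), compact B -> (volume B < c)%E ->
    exists2 rho : R, 0 < rho & (volume (thicken rho B) < c)%E) ->
  compact A -> (volume (section_at x A) < c)%E ->
  \forall d \near (0 : R)^'+, forall x' : 'rV[R]_p,
    (forall i, `|x 0 i - x' 0 i| <= d) -> (volume (section_at x' A) < c)%E.
Proof.
move=> usc cA /usc [] => [|rho rho0 vc]; first exact: compact_section.
have := section_thicken x cA rho0; apply: filterS => d sub x' xx'.
by apply: le_lt_trans vc; apply: le_volume; exact: sub.
Qed.

(** The volume of the section is upper semicontinuous in x; a double negation reduces this to the
    measurability of lower semicontinuous functions. *)
Lemma measurable_section_of (p : nat) (A : set 'rV[R]_p.+1) :
  (forall (B : set 'rV[R]_p) (c : \bar R), compact B -> (volume B < c)%E ->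
    exists2 rho : R, 0 < rho & (volume (thicken rho B) < c)%E) ->
  compact A ->
  measurable_fun setT (fun x : R => volume (@section_at R 1 p x%:M A)).
Proof.
move=> usc cA.
have -> : (fun x : R => volume (@section_at R 1 p x%:M A)) =
    (fun x => - (- volume (@section_at R 1 p x%:M A)))%E.
  by apply/funext => x; rewrite oppeK.
apply: measurableT_comp => //.
apply: lower_semicontinuous_measurable => x a.
rewrite lteNr => vx.
have [d [d0 near_d]] : exists d : R, 0 < d /\ forall x' : 'rV[R]_1,
    (forall i, `|(x%:M : 'rV[R]_1) 0 i - x' 0 i| <= d) ->
    (volume (section_at x' A) < - a%:E)%E.
  near (0 : R)^'+ => d; exists d; split => //; near: d.
  exact: section_volume_usc_of.
exists (ball x d); first exact: nbhsx_ballx.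
move=> y /ltW xy; rewrite lteNr; apply: near_d => i.
by rewrite (ord1 i) !mxE eqxx !mulr1n.
Unshelve. all: by end_near. Qed.

Lemma near_Sinv_le (e : R) : 0 < e -> \forall j \near \oo, j.+1%:R^-1 <= e.
Proof.
by move=> e0; apply: filterS (near_infty_natSinv_lt (PosNum e0)) => j /ltW.
Qed.

(* Volume is upper semicontinuous on compact sets: dominated convergence on the
   sections of the thickenings of A. *)
Lemma volume_usc (p : nat) (A : set 'rV[R]_p) (c : \bar R) : compact A ->
  (volume A < c)%E -> exists2 rho : R, 0 < rho & (volume (thicken rho A) < c)%E.
Proof.
elim: p A c => [|p IH] A c cA Ac.
  exists 1 => //; apply: le_lt_trans Ac; apply: le_volume => x [y Ay _].
  by rewrite (_ : x = y) //; apply/rowP => -[].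
pose t j := thicken (j.+1%:R^-1) A.
have ct j : compact (t j) by exact: compact_thicken.
pose f j (x : R) := volume (@section_at R 1 p x%:M (t j)).
pose g (x : R) := volume (@section_at R 1 p x%:M A).
have mf j : measurable_fun setT (f j) by exact: measurable_section_of.
have mg : measurable_fun setT g by exact: measurable_section_of.
have inv_le j : (j.+1%:R^-1 : R) <= 1%:R^-1.
  by rewrite lef_pV2 ?posrE // ler_nat.
have fin (B : set 'rV[R]_p) : compact B -> volume B \is a fin_num.
  by move=> cB; rewrite ge0_fin_numE ?volume_ge0 // volume_compact_lty.
have fg x : (fun j => f j x) @ \oo --> g x.
  have cs : compact (@section_at R 1 p x%:M A) by exact: compact_section.
  have gfin : g x \is a fin_num by exact: fin.
  rewrite -(fineK gfin); apply/fine_cvgP; split.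
    by apply: nearW => j; apply/fin/compact_section.
  apply/cvgrPdist_lt => e e0.
  have : (g x < g x + e%:E)%E by rewrite lteDl ?lte_fin.
  move=> /(IH _ _ cs) [rho rho0 vrho].
  (* The sections of the thickened set differ from that of A in two ways, each charged rho / 2: the
     base point moves away from x, and the fiber itself is thickened. *)
  have rho2 : 0 < rho / 2 by rewrite divr_gt0.
  have [d [d0 near_d]] : exists d : R, 0 < d /\ forall x' : 'rV[R]_1,
      (forall i, `|(x%:M : 'rV[R]_1) 0 i - x' 0 i| <= d) ->
      section_at x' A `<=` thicken (rho / 2) (section_at x%:M A).
    near (0 : R)^'+ => d; exists d; split => //; near: d.
    exact: section_thicken.
  near=> j.
  have jd : j.+1%:R^-1 <= d by near: j; exact: near_Sinv_le.
  have jr : j.+1%:R^-1 <= rho / 2 by near: j; exact: near_Sinv_le.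
  have sub : @section_at R 1 p x%:M (t j) `<=`
      thicken rho (@section_at R 1 p x%:M A).
    move=> y [z Az zy].
    have {}zy (i : 'I_(1 + p)) :
        `|(z : 'rV[R]_(1 + p)) 0 i - row_mx (x%:M : 'rV[R]_1) y 0 i| <= j.+1%:R^-1.
      exact: zy.
    rewrite [rho]splitr; apply: thicken_thicken; exists (@rsubmx R 1 1 p z).
      apply: (near_d (@lsubmx R 1 1 p z)); last by rewrite /section_at /= hsubmxK.
      move=> i; rewrite distrC (le_trans _ jd) //.
      have := zy (lshift p i); rewrite row_mxEl [lsubmx _ _ _]mxE; exact.
    move=> i; rewrite (le_trans _ jr) //.
    have := zy (rshift 1 i); rewrite row_mxEr [rsubmx _ _ _]mxE; exact.
  have fjle : (f j x < g x + e%:E)%E by exact: le_lt_trans (le_volume sub) vrho.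
  have gle : (g x <= f j x)%E.
    by apply: le_volume => y Ay; apply: subset_thicken.
  have fj : f j x \is a fin_num by apply/fin/compact_section.
  rewrite -(fineK fj) -(fineK gfin) in fjle gle.
  rewrite distrC ger0_norm; last by rewrite subr_ge0 -lee_fin.
  by rewrite ltrBlDl -lte_fin EFinD.
(* The thickenings decrease with j, so the first one dominates; it is compact, hence of finite
   volume. *)
have f0 : mu.-integrable setT (f 0%N).
  apply/integrableP; split; first exact: mf.
  have -> : (fun x => `|f 0%N x|)%E = f 0%N.
    by apply/funext => x; rewrite gee0_abs ?volume_ge0.
  exact: volume_compact_lty (ct 0%N).
have fle x j : (`|f j x| <= f 0%N x)%E.
  rewrite gee0_abs ?volume_ge0 //; apply: le_volume => y.
  by apply: thickenS; rewrite (le_trans (inv_le j)).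
have cvgf : (fun j => \int[mu]_x f j x)%E @ \oo --> (\int[mu]_x g x)%E.
  have [| |_ _ //] := @dominated_convergence _ _ _ mu setT measurableT f g (f 0%N)
    mf mg _ f0 _.
  - by apply: aeW => x _; exact: fg.
  - by apply: aeW => x j _; exact: fle.
near \oo => j; exists (j.+1%:R^-1) => //.
rewrite -/(t j) volumeS_section; near: j.
exact: (cvgf _ (open_ereal_lt' Ac)).
Unshelve. all: by end_near. Qed.

End volume_theory.

(** * Measurability of sections, translations, exchange of two coordinates *)

Section volume_linear.
Context {R : realType}.
Local Notation mu := (@lebesgue_measure R).

Lemma measurable_section (p : nat) (A : set 'rV[R]_p.+1) : compact A ->
  measurable_fun setT (fun x : R => volume (@section_at R 1 p x%:M A)).
Proof. by move=> cA; apply: measurable_section_of => // B c; exact: volume_usc. Qed.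

(** U is the countable union of the rational squares that it contains; [V] replaces the other
    squares by the empty set. *)
Lemma open_measurable_prod (U : set (R * R)) : open U -> measurable U.
Proof.
move=> oU.
pose B (c : rat * rat * rat) : set (R * R) :=
  `](ratr c.1.1 - ratr c.2), (ratr c.1.1 + ratr c.2)[ `*`
  `](ratr c.1.2 - ratr c.2), (ratr c.1.2 + ratr c.2)[.
pose V c := if `[< B c `<=` U >] then B c else set0.
have -> : U = \bigcup_a \bigcup_b \bigcup_r V (a, b, r).
  apply/seteqP; split => [[x y] Uxy|t [a _ [b _ [r _ /=]]]]; last first.
    by rewrite /V; case: ifPn => // /asboolP; exact.
  have /nbhs_ballP[e /= e0 eU] : nbhs (x, y) U by exact: open_nbhs_nbhs.
  have [r] : exists r : rat, ratr r \in `]0, (e / 2)[.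
    by apply: rat_in_itvoo; rewrite divr_gt0.
  rewrite in_itv /= => /andP[r0 re].
  have [a] : exists a : rat, ratr a \in `](x - ratr r), (x + ratr r)[.
    by apply: rat_in_itvoo; lra.
  rewrite in_itv /= => /andP[a1 a2].
  have [b] : exists b : rat, ratr b \in `](y - ratr r), (y + ratr r)[.
    by apply: rat_in_itvoo; lra.
  rewrite in_itv /= => /andP[b1 b2].
  exists a => //; exists b => //; exists r => //; rewrite /V ifT; last first.
    apply/asboolP => -[u v] []; rewrite /= !in_itv /= => /andP[? ?] /andP[? ?].
    by apply: eU; split; rewrite /ball /= ltr_norml; apply/andP; split; lra.
  by split; rewrite /= in_itv /=; apply/andP; split; lra.
do 3 (apply: bigcupT_measurable_rat => ?).
rewrite /V; case: ifPn => // _; apply: measurableX; exact: measurable_itv.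
Qed.

Definition row2 (z : R * R) : 'rV[R]_(1 + 1) := row_mx z.1%:M z.2%:M.

(** By semicontinuity the sets where the volume is below a bound are open in the plane. Joint
    measurability in both coordinates is what Tonelli's theorem requires in [volume_swap]. *)
Lemma measurable_section2 (p : nat) (A : set 'rV[R]_p.+2) : compact A ->
  measurable_fun setT (fun z : R * R => volume (@section_at R 2 p (row2 z) A)).
Proof.
move=> cA.
have -> : (fun z : R * R => volume (@section_at R 2 p (row2 z) A)) =
    (fun z => - (- volume (@section_at R 2 p (row2 z) A)))%E.
  by apply/funext => z; rewrite oppeK.
apply: measurableT_comp => //.
apply: (measurability _ (ErealGenOInfty.measurableE R)) => /= _ [_ [a ->]] <-.
rewrite setTI preimage_itvoy; apply: open_measurable_prod.
rewrite openE => -[x y] /=; rewrite lteNr => vxy.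
have [d [d0 near_d]] : exists d : R, 0 < d /\ forall x' : 'rV[R]_2,
    (forall i, `|row2 (x, y) 0 i - x' 0 i| <= d) ->
    (volume (@section_at R 2 p x' A) < - a%:E)%E.
  near (0 : R)^'+ => d; exists d; split => //; near: d.
  by apply: (@section_volume_usc_of _ 2 p A) => // B c; exact: volume_usc.
apply/nbhs_ballP; exists d => //= -[x' y'] [/ltW /= xx' /ltW yy'].
rewrite /= lteNr; apply: near_d => i.
case: (@split_ordP 1 1 i) => j ->; rewrite (ord1 j) /row2.
  by rewrite (row_mxEl (x%:M : 'M[R]_1)) (row_mxEl (x'%:M : 'M[R]_1)) !mxE !mulr1n.
by rewrite (row_mxEr (x%:M : 'M[R]_1)) (row_mxEr (x'%:M : 'M[R]_1)) !mxE !mulr1n.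
Unshelve. all: by end_near. Qed.

(** The dimensions 1 + (p + q) and 1 + p + q are convertible, so the cast in [row_mxA] is along a
    trivial equality and disappears. *)
Lemma row_mx1A (p q : nat) (x : 'rV[R]_1) (y : 'rV[R]_p) (z : 'rV[R]_q) :
  row_mx x (row_mx y z) = row_mx (row_mx x y) z :> 'rV[R]_(1 + p + q).
Proof.
rewrite row_mxA.
by rewrite (eq_irrelevance (esym (addnA 1 p q)) (erefl (1 + p + q)%N)) castmx_id.
Qed.

Lemma section_section (p q : nat) (x : 'rV[R]_1) (y : 'rV[R]_p)
    (A : set 'rV[R]_(1 + p + q)) :
  section_at y (@section_at R 1 (p + q) x A) = section_at (row_mx x y) A.
Proof. by apply/seteqP; split => z; rewrite /section_at /= row_mx1A. Qed.

Lemma image_mx_comp (p q r : nat) (A : set 'rV[R]_p) (M : 'M[R]_(p, q))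
    (N : 'M[R]_(q, r)) : image_mx (image_mx A M) N = image_mx A (M *m N).
Proof.
apply/seteqP; split => [_ [_ [x Ax <-] <-]|_ [x Ax <-]].
  by exists x => //; rewrite mulmxA.
by exists (x *m M); [exists x | rewrite mulmxA].
Qed.

Lemma image_mx1 (p : nat) (A : set 'rV[R]_p) : image_mx A 1%:M = A.
Proof.
apply/seteqP; split => [_ [x Ax <-]|x Ax]; first by rewrite mulmx1.
by exists x => //; rewrite mulmx1.
Qed.

Lemma image_mx_inv (p : nat) (A : set 'rV[R]_p) (M N : 'M[R]_p) :
  N *m M = 1%:M -> image_mx A M = [set x | A (x *m N)].
Proof.
move=> NM; have MN := mulmx1C NM.
apply/seteqP; split => [_ [x Ax <-]|x Ax] /=; first by rewrite -mulmxA MN mulmx1.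
by exists (x *m N) => //; rewrite -mulmxA NM mulmx1.
Qed.

Lemma section_translate (p q : nat) (A : set 'rV[R]_(p + q))
    (v : 'rV[R]_(p + q)) (x : 'rV[R]_p) :
  section_at x [set z + v | z in A] =
  [set y + rsubmx v | y in section_at (x - lsubmx v) A].
Proof.
apply/seteqP; split => [y [z Az zE]|_ [y Ay <-]].
  exists (y - rsubmx v); last by rewrite subrK.
  rewrite /section_at /= (_ : row_mx _ _ = z) //.
  by apply/(addIr v); rewrite zE -{3}(hsubmxK v) add_row_mx !subrK.
rewrite /section_at /=; exists (row_mx (x - lsubmx v) y) => //.
by rewrite -{2}(hsubmxK v) add_row_mx subrK.
Qed.

Lemma volume_translate (p : nat) (A : set 'rV[R]_p) (v : 'rV[R]_p) : compact A ->
  volume [set x + v | x in A] = volume A.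
Proof.
elim: p A v => [|p IH] A v cA.
  congr volume; apply/seteqP; split => [_ [x Ax <-]|x Ax].
    by rewrite (_ : x + v = x) //; apply/rowP => -[].
  by exists x => //; apply/rowP => -[].
pose f (x : R) := volume (@section_at R 1 p x%:M A).
have -> : volume [set x + v | x in A] = (\int[mu]_x f (x * 1 + - v 0 0)%R)%E.
  rewrite volumeS_section; apply: eq_integral => x _.
  rewrite -[RHS](IH _ (@rsubmx R 1 1 p v)); last exact: compact_section.
  rewrite section_translate; rewrite /f.
  suff -> : x%:M - @lsubmx R 1 1 p v = (x * 1 + - v 0 0)%:M by [].
  apply/matrixP => i j; rewrite !ord1 !mxE eqxx !mulr1n mulr1.
  by rewrite (_ : lshift p 0 = 0) //; exact: val_inj.
rewrite (@ge0_integral_affine _ 1 (- v 0 0) f) //; last 2 first.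
- exact: measurable_section.
- by move=> x; exact: volume_ge0.
by rewrite normr1 invr1 mul1e.
Qed.

(** Exchanging the first two coordinates exchanges the two outermost integrals, which Tonelli's
    theorem permits. *)
Lemma volume_swap (p : nat) (A : set 'rV[R]_p.+2) : compact A ->
  volume (image_mx A (perm_mx (tperm 0 (lift 0 0) : 'S_p.+2))) = volume A.
Proof.
move=> cA; set t : 'S_p.+2 := tperm _ _.
have tt : perm_mx t *m perm_mx t = 1%:M :> 'M[R]_p.+2.
  by rewrite -perm_mxM tperm2 perm_mx1.
rewrite (image_mx_inv _ tt).
have secE (B : set 'rV[R]_p.+2) : volume B =
    (\int[mu]_x \int[mu]_y volume (@section_at R 2 p (row2 (x, y)) B))%E.
  rewrite volumeS_section; apply: eq_integral => x _.
  rewrite volumeS_section; apply: eq_integral => y _.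
  congr volume; exact: (@section_section 1 p x%:M y%:M B).
rewrite !secE.
have ft := @fubini_tonelli _ _ _ _ R mu mu
  (fun z : R * R => volume (@section_at R 2 p (row2 z) A)) (measurable_section2 cA)
  (fun z => volume_ge0 _).
rewrite [RHS]ft; apply: eq_integral => x _; apply: eq_integral => y _.
congr volume; apply/seteqP.
suff H z : @row_mx R 1 2 p (row2 (x, y)) z *m perm_mx t =
    @row_mx R 1 2 p (row2 (y, x)) z.
  by split => z; rewrite /section_at /= H.
rewrite -[t]tpermV -col_permE; apply/rowP => i; rewrite mxE.
rewrite /row2 -!row_mx1A.
case: (unliftP 0 i) => [j ->|->]; last first.
  by rewrite tpermL row_mx1_0 row_mx1_lift row_mx1_0.
case: (unliftP 0 j) => [k ->|->]; last first.
  by rewrite tpermR row_mx1_0 row_mx1_lift row_mx1_0.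
have -> : t (lift 0 (lift 0 k)) = lift 0 (lift 0 k).
  by rewrite /t tpermD // (inj_eq lift_inj).
by rewrite row_mx1_lift row_mx1_lift row_mx1_lift row_mx1_lift.
Qed.

End volume_linear.

(** * Linear change of variables and Cavalieri's principle *)

Section volume_det.
Context {R : realType}.
Local Notation mu := (@lebesgue_measure R).

Lemma integral_point_support (a : R) (f : R -> \bar R) :
  (forall x, x != a -> f x = 0%E) -> (\int[mu]_x f x = 0)%E.
Proof.
move=> fa; rewrite -(integral_set1 f a) [RHS]integral_mkcond.
apply: eq_integral => x _; rewrite /patch; case: ifPn => //.
by rewrite notin_setE => /eqP; exact: fa.
Qed.

(** For u != 0 the fiber of the image over x is the fiber of A over x / u, mapped by N and
    translated by (x / u) w; the substitution x / u contributes |u|. For u = 0 the image lies over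
    the single point 0. *)
Lemma volume_block_mulmx (p : nat) (A : set 'rV[R]_p.+1) (u c : R)
    (w : 'rV[R]_p) (N : 'M[R]_p) : compact A ->
  (forall B : set 'rV[R]_p, compact B ->
    (volume (image_mx B N) = `|c|%:E * volume B)%E) ->
  (volume (image_mx A (block_mx (u%:M : 'M[R]_1) w 0 N)) =
   `|u * c|%:E * volume A)%E.
Proof.
move=> cA IH; pose M := block_mx (u%:M : 'M[R]_1) w 0 N.
have rowM (x : 'rV[R]_1) (y : 'rV[R]_p) :
    row_mx x y *m M = row_mx (u *: x) (x *m w + y *m N).
  by rewrite mul_row_block mulmx0 addr0 mul_mx_scalar.
rewrite -/M; have cM : compact (image_mx A M) by exact: (@compact_image_mulmx R (1 + p) (1 + p)).
have [u0|u0] := eqVneq u 0.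
  rewrite -/M [in RHS]u0 mul0r normr0 mul0e volumeS_section.
  apply: (@integral_point_support 0) => x x0.
  rewrite (_ : section_at _ _ = set0) ?volume_set0 //.
  apply/seteqP; split => // y [z Az]; rewrite -(@hsubmxK _ 1 1 p z).
  move=> zE; have /eq_row_mx[/matrixP/(_ 0 0) + _] := etrans (esym (rowM _ _)) zE.
  rewrite !mxE u0 mul0r eqxx mulr1n => xE.
  by move: x0; rewrite -xE eqxx.
pose f (x : R) := volume (@section_at R 1 p x%:M A).
have -> : volume (image_mx A M) =
    (\int[mu]_x (`|c|%:E * f (x * u^-1 + 0)%R))%E.
  rewrite volumeS_section; apply: eq_integral => x _.
  rewrite addr0 -IH; last exact: compact_section.
  pose v := (x * u^-1)%:M : 'rV[R]_1.
  rewrite -[RHS](volume_translate (v *m w)); last first.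
    by apply: compact_image_mulmx; exact: compact_section.
  congr volume; apply/seteqP; split => [y [z Az]|_ [_ [y Ay <-] <-]].
    rewrite -(@hsubmxK _ 1 1 p z).
    move=> zE0; have /eq_row_mx[zv zw] := etrans (esym (rowM _ _)) zE0.
    have zE : @lsubmx R 1 1 p z = v.
      by rewrite /v -scalemx1 mulrC -scalerA scalemx1 -zv scalerA mulVf // scale1r.
    exists (@rsubmx R 1 1 p z *m N); last by rewrite -zw zE addrC.
    by exists (@rsubmx R 1 1 p z) => //; rewrite /section_at /= -/v -zE hsubmxK.
  exists (row_mx v y) => //.
  rewrite rowM addrC; congr row_mx.
  by rewrite /v scale_scalar_mx mulrCA divff ?mulr1.
have mf : measurable_fun setT f by exact: measurable_section.
have f0 x : (0 <= f x)%E by exact: volume_ge0.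
rewrite ge0_integralZl_EFin //; last first.
  have mg : measurable_fun setT (fun x : R => (x * u^-1 + 0 : R)).
    by apply: measurable_funD => //; apply: measurable_funM.
  exact: (measurableT_comp mf mg).
rewrite (@ge0_integral_affine _ u^-1 0 f) ?invr_neq0 // normfV invrK.
by rewrite muleA -EFinM -normrM mulrC volumeS_section.
Qed.

Lemma volume_upper_mulmx (p : nat) (A : set 'rV[R]_p) (U : 'M[R]_p) :
  (forall i j : 'I_p, (j < i)%N -> U i j = 0) -> compact A ->
  (volume (image_mx A U) = `|\det U|%:E * volume A)%E.
Proof.
elim: p A U => [|p IH] A U Uu cA.
  rewrite det_mx00 normr1 mul1e; congr volume.
  by rewrite [U]flatmx0 -[RHS]image_mx1 [1%:M]flatmx0.
have ul : @ulsubmx R 1 p 1 p U = (U 0 0)%:M.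
  by apply/matrixP => i j; rewrite !ord1 !mxE mulr1n; congr (U _ _); exact: val_inj.
have dl : @dlsubmx R 1 p 1 p U = 0.
  by apply/matrixP => i j; rewrite !mxE Uu //= !ord1.
rewrite -(@submxK R 1 p 1 p U) ul dl.
set w := ursubmx _; set N := drsubmx _.
have dE : \det (block_mx ((U 0 0)%:M : 'M[R]_1) w 0 N) = U 0 0 * \det N.
  by rewrite det_ublock det_scalar1.
have := @volume_block_mulmx p A (U 0 0) (\det N) w N cA; rewrite -dE; apply.
by move=> B cB; apply: IH => // i j ij; rewrite !mxE Uu.
Qed.

(** A transposition fixing 0 is a block matrix over a smaller transposition, hence covered by
    induction. The transposition of 0 and j >= 2 is the conjugate of the swap of 0 and 1 by that of
    1 and j. *)
Lemma volume_tperm_mulmx (p : nat) (A : set 'rV[R]_p) (i j : 'I_p) : compact A ->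
  volume (image_mx A (perm_mx (tperm i j))) = volume A.
Proof.
elim: p A i j => [|p IH] A i j cA; first by case: i.
have lift_lift (B : set 'rV[R]_p.+1) (i' j' : 'I_p) : compact B ->
    volume (image_mx B (perm_mx (tperm (lift 0 i') (lift 0 j')))) = volume B.
  move=> cB.
  have <- : lift0_perm (tperm i' j') = tperm (lift 0 i') (lift 0 j').
    apply/permP => k; case: (unliftP 0 k) => [k' ->|->].
      by rewrite lift0_perm_lift (inj_tperm _ _ _ lift_inj).
    by rewrite lift0_perm0 tpermD.
  rewrite -lift0_mx_perm /lift0_mx (_ : 1 = (1 : R)%:M) //.
  rewrite (@volume_block_mulmx p B 1 1) ?mulr1 ?normr1 ?mul1e // => C cC.
  by rewrite IH // mul1e.
have zero_lift (B : set 'rV[R]_p.+1) (j' : 'I_p) : compact B ->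
    volume (image_mx B (perm_mx (tperm 0 (lift 0 j')))) = volume B.
  case: p j' B IH lift_lift {A cA i j} => [[]//|p] j' B IH lift_lift cB.
  case: (unliftP 0 j') => [k|] ->; last exact: volume_swap.
  set s := tperm (lift 0 0) (lift 0 (lift 0 k)) : 'S_p.+2.
  have -> : tperm 0 (lift 0 (lift 0 k)) =
      (s * tperm 0 (lift 0 0) * s)%g :> 'S_p.+2.
    have -> : (s * tperm 0 (lift 0 0) * s)%g = (tperm 0 (lift 0 0) ^ s)%g.
      by rewrite /conjg tpermV mulgA.
    by rewrite tpermJ tpermL tpermD.
  rewrite !perm_mxM -!image_mx_comp lift_lift; last first.
    by do 2 apply: compact_image_mulmx.
  rewrite volume_swap; last exact: compact_image_mulmx.
  exact: lift_lift.
case: (unliftP 0 i) (unliftP 0 j) => [i'|] -> [j'|] ->.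
- exact: lift_lift.
- by rewrite tpermC; exact: zero_lift.
- exact: zero_lift.
- by rewrite tperm1 perm_mx1 image_mx1.
Qed.

Lemma volume_perm_mulmx (p : nat) (A : set 'rV[R]_p) (s : 'S_p) : compact A ->
  volume (image_mx A (perm_mx s)) = volume A.
Proof.
have [ts -> _] := prod_tpermP s; elim: ts A => [|t ts IH] A cA.
  by rewrite big_nil perm_mx1 image_mx1.
rewrite big_cons perm_mxM -image_mx_comp IH; last exact: compact_image_mulmx.
exact: volume_tperm_mulmx.
Qed.

(** Conjugation by the order-reversing permutation turns L into an upper triangular matrix with the
    same determinant. *)
Lemma volume_lower_mulmx (p : nat) (A : set 'rV[R]_p) (L : 'M[R]_p) :
  (forall i j : 'I_p, (i < j)%N -> L i j = 0) -> compact A ->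
  (volume (image_mx A L) = `|\det L|%:E * volume A)%E.
Proof.
move=> Ll cA; pose s : 'S_p := perm (@rev_ord_inj p).
have ss : perm_mx s *m perm_mx s = 1%:M :> 'M[R]_p.
  rewrite -perm_mxM (_ : (s * s)%g = 1%g) ?perm_mx1 //.
  by apply/permP => i; rewrite permM !permE rev_ordK.
pose U := perm_mx s *m L *m perm_mx s.
have -> : L = perm_mx s *m U *m perm_mx s.
  by rewrite /U !mulmxA ss mul1mx -mulmxA ss mulmx1.
have Uu (i j : 'I_p) : (j < i)%N -> U i j = 0.
  move=> ji.
  have -> : U = col_perm s^-1 (row_perm s L) by rewrite col_permE row_permE invgK.
  rewrite !mxE Ll //.
  have -> : (s^-1)%g = s by apply/eqP; rewrite eq_invg_mul; apply/eqP/permP => k;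
    rewrite permM !permE rev_ordK.
  by rewrite !permE /=; have := ltn_ord i; have := ltn_ord j; lia.
have cP (B : set 'rV[R]_p) : compact B -> compact (image_mx B (perm_mx s)) by exact: compact_image_mulmx.
rewrite -2!image_mx_comp volume_perm_mulmx; last by do 2 apply: compact_image_mulmx.
rewrite volume_upper_mulmx //; last exact: compact_image_mulmx.
rewrite volume_perm_mulmx // (det_mulmx (perm_mx s *m U)) (det_mulmx (perm_mx s) U).
have d2 : \det (perm_mx s) * \det (perm_mx s) = 1 :> R.
  by rewrite -det_mulmx ss det1.
by rewrite mulrAC d2 mul1r.
Qed.

(** The LUP decomposition covers singular N too: it writes N as a permutation, a lower triangular
    factor of determinant 1 and an upper triangular factor that carries the determinant up to
    sign. *)
Lemma volume_mulmx (p : nat) (A : set 'rV[R]_p) (N : 'M[R]_p) : compact A ->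
  (volume (image_mx A N) = `|\det N|%:E * volume A)%E.
Proof.
case: p A N => [|p] A N cA.
  by apply: volume_upper_mulmx => // -[].
have := cormen_lup_correct N; have := cormen_lup_perm N.
have := cormen_lup_detL N; have := @cormen_lup_lower _ _ N.
have := @cormen_lup_upper _ _ N.
case: (cormen_lup N) => [[P L] U] Uu Ll dL Pp PN; rewrite /= in Uu Ll dL Pp PN.
have /is_perm_mxP[s Ps] := Pp; rewrite Ps in PN.
have Llt (i j : 'I_p.+1) : (i < j)%N -> L i j = 0.
  move=> ij; rewrite Ll ?(ltnW ij) //.
  by have -> : (i == j) = false by apply: negbTE; rewrite neq_ltn ij.
have sN : perm_mx s *m N = L *m U by exact: PN.
have -> : N = perm_mx s^-1 *m L *m U.
  by rewrite -mulmxA -sN mulmxA -perm_mxM mulVg perm_mx1 mul1mx.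
rewrite -!image_mx_comp volume_upper_mulmx //; last first.
  by do 2 apply: compact_image_mulmx.
rewrite (volume_lower_mulmx Llt); last exact: compact_image_mulmx.
rewrite volume_perm_mulmx // dL normr1 mul1e !det_mulmx dL det_perm mulr1.
by rewrite normrM normr_sign mul1r.
Qed.

(* Cavalieri's principle; volume integrates over the first p coordinates last. *)
Lemma volume_fiber_le (p q : nat) (A : set 'rV[R]_(p + q)) (B : set 'rV[R]_p)
    (c : R) : compact A -> compact B -> 0 <= c ->
  (forall w, (volume (section_at w A) <= c%:E)%E) ->
  (forall w y, A (row_mx w y) -> B w) ->
  (volume A <= c%:E * volume B)%E.
Proof.
move=> cA cB c0; elim: p A B cA cB => [|p IH] A B cA cB Ac AB.
  have A0 : section_at (0 : 'rV_0) A = A.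
    by apply/seteqP; split => y; rewrite /section_at /= row_thin_mx.
  have [B0|B0] := pselect (B 0).
    by rewrite volume0_in // mule1 -{1}A0.
  rewrite (_ : A = set0) ?volume_set0 ?mule_ge0 ?volume_ge0 ?lee_fin //.
  apply/seteqP; split => // y Ay; apply: B0; apply: (AB _ y).
  by rewrite row_thin_mx.
rewrite !volumeS_section -ge0_integralZl_EFin //; last 2 first.
- by move=> x _; exact: volume_ge0.
- exact: measurable_section.
apply: le_lower_integral => x _; first exact: volume_ge0.
apply: IH => [||w|w y Aw].
- exact: compact_section.
- exact: compact_section.
- by rewrite (@section_section _ p q x%:M w); exact: Ac.
- by apply: (AB _ y); move: Aw; rewrite /section_at /= row_mx1A.
Qed.

Lemma volume_fiber_ge (p q : nat) (A : set 'rV[R]_(p + q)) (B : set 'rV[R]_p)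
    (c : R) : compact A -> compact B -> 0 <= c ->
  (forall w, B w -> (c%:E <= volume (section_at w A))%E) ->
  (c%:E * volume B <= volume A)%E.
Proof.
move=> cA cB c0; elim: p A B cA cB => [|p IH] A B cA cB Ac.
  have A0 : section_at (0 : 'rV_0) A = A.
    by apply/seteqP; split => y; rewrite /section_at /= row_thin_mx.
  have [B0|B0] := pselect (B 0).
    by rewrite volume0_in // mule1 -[in leRHS]A0; exact: Ac.
  by rewrite volume0_notin // mule0 volume_ge0.
rewrite !volumeS_section -ge0_integralZl_EFin //; last 2 first.
- by move=> x _; exact: volume_ge0.
- exact: measurable_section.
apply: le_lower_integral => x _; first by rewrite mule_ge0 ?volume_ge0.
apply: IH => [||w Bw].
- exact: compact_section.
- exact: compact_section.
- by rewrite (@section_section _ p q x%:M w); exact: Ac.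
Qed.

End volume_det.

(** * Volume of generalized cross-polytopes *)

(** For a, b >= 0 this is a S - b S, where S is the convex hull of 0 and the unit vectors: a point
    is the difference of its positive and negative parts. It is empty when a or b is negative. *)
Definition cross (R : realType) (d : nat) (a b : R) : set 'rV[R]_d :=
  [set x | \sum_i Num.max (x 0 i) 0 <= a /\ \sum_i Num.max (- x 0 i) 0 <= b].
Arguments cross {R} d a b _ : rename.

Section cross.
Context {R : realType}.
Local Notation mu := (@lebesgue_measure R).

Lemma max_part_ge0 (x : R) : 0 <= Num.max x 0.
Proof. by rewrite le_max lexx orbT. Qed.

Lemma compact_cross (d : nat) (a b : R) : compact (cross d a b).
Proof.
have cB := @compact_box R d (fun=> - b) (fun=> a).
have -> : cross d a b = [set x : 'rV[R]_d | forall i, - b <= x 0 i <= a] `&`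
    ((fun x : 'rV[R]_d => \sum_i Num.max (x 0 i) 0) @^-1` [set y | y <= a] `&`
     (fun x : 'rV[R]_d => \sum_i Num.max (- x 0 i) 0) @^-1` [set y | y <= b]).
  apply/seteqP; split => [x [xa xb]|x []//]; split => // i.
  apply/andP; split.
    rewrite lerNl (le_trans _ xb) // (bigD1 i) //=.
    by rewrite ler_wpDr ?sumr_ge0 // => [j _|]; rewrite ?max_part_ge0 // le_max lexx.
  rewrite (le_trans _ xa) // (bigD1 i) //=.
  by rewrite ler_wpDr ?sumr_ge0 // => [j _|]; rewrite ?max_part_ge0 // le_max lexx.
have cmax (f : 'rV[R]_d -> R) : continuous f -> continuous (fun x => Num.max (f x) 0).
  move=> cf x; apply: (@continuous_comp _ _ _ f (fun y : R => Num.max y 0)).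
    exact: cf.
  by apply: continuous_max; [exact: cvg_id | exact: cvg_cst].
apply: compact_closedI => //; apply: closedI; apply: closed_comp.
- move=> x _; apply: continuous_sum => i; apply: cmax; exact: coord_continuous.
- exact: closed_le.
- move=> x _; apply: continuous_sum => i; apply: cmax => y.
  by apply: (@continuousN _ R^o); exact: coord_continuous.
- exact: closed_le.
Qed.

(** The volume of the simplex a S in dimension d. Integrating this divided power raises its index by
    one, as slicing the simplex does. *)
Definition mono_fact (d : nat) (a : R) : R := a ^+ d / d`!%:R.

Lemma mono_fact_ge0 d a : 0 <= a -> 0 <= mono_fact d a.
Proof. by move=> a0; rewrite divr_ge0 ?exprn_ge0. Qed.

Lemma continuous_exp (T : topologicalType) (n : nat) (f : T -> R) :
  continuous f -> continuous (fun x => f x ^+ n).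
Proof.
move=> cf; elim: n => [|n IH].
  by under eq_fun do rewrite expr0; exact: cst_continuous.
by under eq_fun do rewrite exprS; exact: continuous_mul.
Qed.

Lemma integral_mono_fact (d : nat) (a : R) : 0 <= a ->
  (\int[mu]_(x in `[0%R, a]) (mono_fact d (a - x))%:E = (mono_fact d.+1 a)%:E)%E.
Proof.
rewrite le_eqVlt => /predU1P[<-|a0].
  by rewrite set_itv1 integral_set1 /mono_fact expr0n mul0r.
pose F (x : R) : R := - (d.+1)`!%:R^-1 *: (a - x) ^+ d.+1.
have d0 : (d.+1)`!%:R != 0 :> R by rewrite pnatr_eq0 -lt0n fact_gt0.
have dF (x : R) : is_derive x 1 F (mono_fact d (a - x)).
  have dB : is_derive x 1 (fun y : R => a - y) (-1).
    by apply: is_derive_eq; rewrite add0r mul1r.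
  have -> : F = (- (d.+1)`!%:R^-1) \*: ((fun y : R => a - y) ^+ d.+1).
    by apply/funext => y; rewrite /F /= exprfctE.
  apply: is_derive_eq.
  rewrite /mono_fact factS natrM /GRing.scale /=; field.
  by rewrite pnatr_eq0 -lt0n fact_gt0 nat1r pnatr_eq0.
have cF (x : R) : {for x, continuous F}.
  by apply/differentiable_continuous/derivable1_diffP; exact: ex_derive.
rewrite (@continuous_FTC2 R _ F) //.
- rewrite /F subrr expr0n scaler0 subr0 sub0e -EFinN; congr EFin.
  by rewrite /mono_fact /GRing.scale /= mulNr opprK mulrC.
- apply: continuous_subspaceT; apply: continuous_mul; last exact: cst_continuous.
  apply: continuous_exp => x; apply: (@cvgB _ R^o); [exact: cvg_cst|exact: cvg_id].
- split; last 2 first.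
  + exact/cvg_at_right_filter/cF.
  + exact/cvg_at_left_filter/cF.
  by move=> x _; exact: ex_derive.
- by move=> x _; rewrite derive1E; apply: derive_val.
Qed.

Lemma sum_max_row_mx1 (d : nat) (x : R) (y : 'rV[R]_d) :
  (\sum_i Num.max ((row_mx (x%:M : 'M[R]_1) y : 'rV[R]_d.+1) 0 i) 0 =
   Num.max x 0 + \sum_i Num.max (y 0 i) 0) *
  (\sum_i Num.max (- (row_mx (x%:M : 'M[R]_1) y : 'rV[R]_d.+1) 0 i) 0 =
   Num.max (- x) 0 + \sum_i Num.max (- y 0 i) 0).
Proof.
split; rewrite big_ord_recl row_mx1_0; congr (_ + _); apply: eq_bigr => i _;
  by rewrite row_mx1_lift.
Qed.

Lemma section_cross_ge0 (d : nat) (a b x : R) : 0 <= x ->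
  @section_at R 1 d x%:M (cross d.+1 a b) = cross d (a - x) b.
Proof.
move=> x0; apply/seteqP; split => y; rewrite /section_at /cross /=;
  rewrite !sum_max_row_mx1 (max_l x0) (max_r (_ : - x <= 0)) ?oppr_le0 // add0r;
  by move=> [? ?]; split => //; lra.
Qed.

Lemma section_cross_le0 (d : nat) (a b x : R) : x <= 0 ->
  @section_at R 1 d x%:M (cross d.+1 a b) = cross d a (b + x).
Proof.
move=> x0; apply/seteqP; split => y; rewrite /section_at /cross /=;
  rewrite !sum_max_row_mx1 (max_r x0) (max_l (_ : 0 <= - x)) ?oppr_ge0 // add0r;
  by move=> [? ?]; split => //; lra.
Qed.

Lemma cross_eq0 (d : nat) (a b : R) : a < 0 \/ b < 0 -> cross d a b = set0.
Proof.
move=> ab; apply/seteqP; split => // x [xa xb].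
have s0 (f : 'I_d -> R) : 0 <= \sum_i Num.max (f i) 0.
  by apply: sumr_ge0 => i _; exact: max_part_ge0.
case: ab => [a0|b0].
  by have := le_lt_trans (le_trans (s0 _) xa) a0; rewrite ltxx.
by have := le_lt_trans (le_trans (s0 _) xb) b0; rewrite ltxx.
Qed.

Lemma mem_cross0 (a b : R) : 0 <= a -> 0 <= b -> cross 0 a b 0.
Proof. by move=> a0 b0; split; rewrite big_ord0. Qed.

Lemma volume_simplex (d : nat) (a : R) : 0 <= a ->
  volume (cross d a 0) = (mono_fact d a)%:E.
Proof.
elim: d a => [|d IH] a a0.
  by rewrite volume0_in ?/mono_fact ?expr0 ?divr1 //; exact: mem_cross0.
rewrite volumeS_section -integral_mono_fact // [RHS]integral_mkcond.
apply: eq_integral => x _; rewrite /patch mem_setE in_itv /=.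
have [x0|x0] := leP 0 x; last first.
  by rewrite section_cross_le0 ?(ltW x0) // cross_eq0 ?volume_set0 // add0r; right.
rewrite section_cross_ge0 //=; case: ifPn => [xa|]; first by rewrite IH ?subr_ge0.
by rewrite -ltNge => ax; rewrite cross_eq0 ?volume_set0 // subr_lt0; left.
Qed.

Lemma integral_cst_itvco (a b c : R) : a <= b ->
  (\int[mu]_(x in `[a, b[) (cst c%:E) x = ((b - a) * c)%:E)%E.
Proof.
move=> ab; rewrite integral_cst //= lebesgue_measure_itv /= lte_fin.
case: ltgtP ab => // [ab _|-> _]; first by rewrite -EFinB -EFinM mulrC.
by rewrite mule0 subrr mul0r.
Qed.

(* Lower bound by the terms of order 0 and 1 in b of the volume
   sum_j C(d, j) (a^(d-j) / (d-j)!) (b^j / j!). *)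
Lemma volume_cross_ge (d : nat) (a b : R) : 0 <= a -> 0 <= b ->
  ((mono_fact d a + d%:R * b * mono_fact d.-1 a)%:E <= volume (cross d a b))%E.
Proof.
elim: d a b => [|d IH] a b a0 b0.
  rewrite volume0_in; last exact: mem_cross0.
  by rewrite mul0r mul0r addr0 /mono_fact expr0 divr1.
have mf := @measurable_section R _ _ (@compact_cross d.+1 a b).
have mI (A : set R) : measurable A ->
    measurable_fun A (fun x => volume (@section_at R 1 d x%:M (cross d.+1 a b))).
  by move=> mA; exact: measurable_funS mf.
(* A first coordinate x >= 0 lowers a, a negative one lowers b. On [[0, a]] the induction hypothesis
   bounds every section; on [[- b, 0[] each section contains the simplex [cross d a 0], and this
   extra b * mono_fact d a raises the coefficient from d to d + 1. *)
pose D := `[0, a]%classic `|` `[- b, 0[%classic : set R.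
have mD : measurable D by apply: measurableU; exact: measurable_itv.
have le_D : (\int[mu]_(x in D) volume (@section_at R 1 d x%:M (cross d.+1 a b)) <=
    volume (cross d.+1 a b))%E.
  rewrite volumeS_section; apply: ge0_subset_integral => //.
  by move=> x _; exact: volume_ge0.
apply: le_trans le_D; rewrite ge0_integral_setU //; last 3 first.
- exact: mI.
- by move=> x _; exact: volume_ge0.
- rewrite disj_set2E; apply/eqP/seteqP; split => // x [] /=.
  by rewrite !in_itv /= => /andP[x0 _] /andP[_ x1]; lra.
have i1 : ((mono_fact d.+1 a + d%:R * b * mono_fact d a)%:E <=
   \int[mu]_(x in `[0%R, a]) volume (@section_at R 1 d x%:M (cross d.+1 a b)))%E.
  have mm j : measurable_fun `[0, a]%classic (fun x : R => (mono_fact j (a - x))%:E).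
    apply/measurable_EFinP; apply: measurable_funS (continuous_measurable_fun _) => //.
    apply: continuous_mul; last exact: cst_continuous.
    apply: continuous_exp => x; apply: (@cvgB _ R^o); [exact: cvg_cst|exact: cvg_id].
  have m0 j x : `[0, a]%classic x -> (0 <= (mono_fact j (a - x))%:E)%E.
    by rewrite /= in_itv /= => /andP[_ xa]; rewrite lee_fin mono_fact_ge0 // subr_ge0.
  have db : 0 <= d%:R * b by rewrite mulr_ge0.
  apply: (@le_trans _ _ (\int[mu]_(x in `[0%R, a])
      ((mono_fact d (a - x))%:E + (d%:R * b)%:E * (mono_fact d.-1 (a - x))%:E))%E).
    rewrite ge0_integralD //; last 4 first.
    - by move=> x xa; exact: m0.
    - exact: mm.
    - by move=> x xa; rewrite mule_ge0 ?m0.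
    - by apply: measurable_funeM; exact: mm.
    rewrite ge0_integralZl_EFin //; last 2 first.
    - by move=> x xa; exact: m0.
    - exact: mm.
    rewrite !integral_mono_fact // -EFinM -EFinD lee_fin.
    (* For d = 0 the truncated predecessor does no harm: its coefficient d is 0. *)
    by case: (d) => [|d'] //; rewrite !mul0r.
  apply: le_lower_integral => x xa; first by rewrite adde_ge0 ?mule_ge0 ?m0.
  have := xa; rewrite /= in_itv /= => /andP[x0 xa'].
  by rewrite section_cross_ge0 // -EFinM -EFinD; apply: IH; rewrite ?subr_ge0.
have i2 : ((b * mono_fact d a)%:E <=
   \int[mu]_(x in `[(- b)%R, 0%R[) volume (@section_at R 1 d x%:M (cross d.+1 a b)))%E.
  have {1}-> : b = 0 - - b by lra.
  rewrite -integral_cst_itvco ?oppr_le0 //; apply: le_lower_integral => x /=.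
    by rewrite lee_fin mono_fact_ge0.
  rewrite in_itv /= => /andP[bx x0].
  rewrite section_cross_le0 ?(ltW x0) // -volume_simplex //; apply: le_volume => y [ya yb].
  by split => //; rewrite (le_trans yb) // -lerBlDr sub0r lerNl.
apply: le_trans (leeD i1 i2); rewrite -EFinD lee_fin /= -nat1r.
by lra.
Qed.

End cross.

(** * Orthonormal frames *)

Section orthonormal.
Context {R : realType}.

Lemma row_sqnorm_gt0 (m : nat) (u : 'rV[R]_m) : u != 0 -> 0 < (u *m u^T) 0 0.
Proof.
move=> u0; rewrite lt_def mxE; apply/andP; split; last first.
  by apply: sumr_ge0 => i _; rewrite mxE -expr2 sqr_ge0.
apply: contra u0 => /eqP S0; apply/eqP/rowP => i; rewrite !mxE; apply/eqP.
rewrite -sqrf_eq0; apply/eqP; have := psumr_eq0P _ S0 => /(_ _ i isT).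
by rewrite mxE -expr2; apply => j _; rewrite mxE -expr2 sqr_ge0.
Qed.

(** Gram-Schmidt: as long as r < rank A, a dimension count gives a nonzero vector of the row space
    of A orthogonal to the rows found so far, which is then normalized. *)
Lemma orthonormal_rows (r s m : nat) (A : 'M[R]_(s, m)) : (r <= \rank A)%N ->
  exists2 b : 'M[R]_(r, m), b *m b^T = 1%:M & (b <= A)%MS.
Proof.
elim: r => [|r IH] rA; first by exists 0; [rewrite [LHS]flatmx0 [RHS]flatmx0 | rewrite sub0mx].
have [b bb bA] := IH (ltnW rA).
pose C := (A :&: kermx b^T)%MS.
have C0 : C != 0.
  rewrite -mxrank_eq0 -lt0n.
  have := mxrank_sum_cap A (kermx b^T); rewrite mxrank_ker mxrank_tr -/C.
  have := rank_leq_col (A + kermx b^T)%MS; have := rank_leq_row b.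
  by have := rank_leq_col b; lia.
pose u := nz_row C; have u0 : u != 0 by rewrite nz_row_eq0.
have uC : (u <= C)%MS by exact: nz_row_sub.
have uA : (u <= A)%MS by apply: submx_trans uC (capmxSl _ _).
have ub : u *m b^T = 0.
  by apply/sub_kermxP; apply: submx_trans uC (capmxSr _ _).
pose t := (Num.sqrt ((u *m u^T) 0 0))^-1; pose v := t *: u.
have vb : v *m b^T = 0 by rewrite -scalemxAl ub scaler0.
have vv : v *m v^T = 1%:M.
  apply/matrixP => i j; rewrite !ord1 -scalemxAl linearZ /= -scalemxAr !mxE eqxx.
  have s0 := row_sqnorm_gt0 u0; rewrite mxE in s0.
  rewrite /t mxE; set S := \sum_ _ _ in s0 *.
  rewrite mulrA -invfM -expr2 sqr_sqrtr ?ltW // mulVf //.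
  by rewrite gt_eqF.
have sub : (col_mx v b <= A)%MS by rewrite col_mx_sub bA andbT /v scalemx_sub.
suff vbvb : col_mx v b *m (col_mx v b)^T = 1%:M by exists (col_mx v b).
rewrite tr_col_mx mul_col_row bb vv vb (_ : b *m v^T = 0) -?scalar_mx_block //.
by apply: trmx_inj; rewrite trmx_mul trmxK vb trmx0.
Qed.

Lemma orthonormal_complete (r s m : nat) (b : 'M[R]_(r, m)) : (r + s = m)%N ->
  b *m b^T = 1%:M ->
  exists2 c : 'M[R]_(s, m), c *m c^T = 1%:M & c *m b^T = 0.
Proof.
move=> rs bb; have rb : \rank b = r.
  apply/eqP; rewrite eqn_leq rank_leq_row /=.
  by have := mxrankM_maxl b b^T; rewrite bb mxrank1.
have [|c cc cb] := @orthonormal_rows s _ _ (kermx b^T).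
  by rewrite mxrank_ker mxrank_tr rb; lia.
by exists c => //; apply/sub_kermxP.
Qed.

Lemma orthonormal_col (r s m : nat) (b : 'M[R]_(r, m)) (c : 'M[R]_(s, m)) :
  b *m b^T = 1%:M -> c *m c^T = 1%:M -> c *m b^T = 0 ->
  col_mx b c *m (col_mx b c)^T = 1%:M.
Proof.
move=> bb cc cb; rewrite tr_col_mx mul_col_row bb cc cb (_ : b *m c^T = 0).
  by rewrite -scalar_mx_block.
by apply: trmx_inj; rewrite trmx_mul trmxK cb trmx0.
Qed.

(** The d rows of T0 leave room for p orthonormal vectors orthogonal to all of them; taken as the
    first columns of N, these produce the zero block. *)
Lemma orthogonal_reduction (p d : nat) (T0 : 'M[R]_(d, p + d)) :
  exists (N : 'M[R]_(p + d)) (D : 'M[R]_d),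
    N *m N^T = 1%:M /\ T0 *m N = row_mx 0 D.
Proof.
have [|b bb bT] := @orthonormal_rows p _ _ (kermx T0^T).
  by rewrite mxrank_ker mxrank_tr; have := rank_leq_row T0; lia.
have [c cc cb] := orthonormal_complete (erefl _ : (p + d = p + d)%N) bb.
exists (col_mx b c)^T, (T0 *m c^T); split.
  by rewrite trmxK; apply: mulmx1C; exact: orthonormal_col.
rewrite tr_col_mx mul_mx_row; congr row_mx.
by apply: trmx_inj; rewrite trmx_mul trmxK trmx0; apply/sub_kermxP.
Qed.

Lemma orthonormal_entry_le1 (r m : nat) (b : 'M[R]_(r, m)) i j :
  b *m b^T = 1%:M -> `|b i j| <= 1.
Proof.
move=> /matrixP/(_ i i); rewrite !mxE eqxx => S1.
rewrite -(@expr_le1 _ 2) // real_normK ?num_real // -[leRHS]S1 (bigD1 j) //=.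
rewrite mxE -expr2 ler_wpDr // sumr_ge0 // => k _.
by rewrite mxE -expr2 sqr_ge0.
Qed.

Lemma grassmannian_frame (n m : nat) (xi : 'M[R]_n) : grassmannian m xi ->
  exists b : 'M[R]_(m, n), orthonormal_frame xi b.
Proof.
move=> [xiT xiK rxi].
have [|b bb bxi] := @orthonormal_rows m _ _ xi; first by rewrite rxi.
exists b; split => //.
have bxiE : b *m xi = b by have /submxP[z ->] := bxi; rewrite -mulmxA xiK.
have rb : \rank b = m.
  apply/eqP; rewrite eqn_leq rank_leq_row /=.
  by have := mxrankM_maxl b b^T; rewrite bb mxrank1.
have /submxP[y yE] : (xi <= b)%MS.
  by have := mxrank_leqif_sup bxi => /leqifP; case: ifP => //; rewrite rb rxi ltnn.
have e1 : xi *m (b^T *m b) = xi.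
  by rewrite {1}yE mulmxA -(mulmxA y) bb mulmx1 -yE.
have := congr1 trmx e1; rewrite !trmx_mul trmxK xiT -mulmxA bxiE => <- //.
Qed.

(** Guarantees that the [get] in [subspace_volume] is a genuine frame and not a default value. *)
Lemma get_frame (n m : nat) (xi : 'M[R]_n) : grassmannian m xi ->
  orthonormal_frame xi (get (@orthonormal_frame R n m xi)).
Proof. by move=> /grassmannian_frame [b bP]; apply: (getPex (ex_intro _ b bP)). Qed.

(** The rank of an orthogonal projection is its trace. Unlike the rank, the trace is continuous, so
    the Grassmannian is seen to be closed. *)
Lemma grassmannian_trace (n m : nat) (xi : 'M[R]_n) :
  grassmannian m xi <-> [/\ xi^T = xi, xi *m xi = xi & \tr xi = m%:R].
Proof.
have tr_rank r : grassmannian r xi -> \tr xi = r%:R.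
  move=> /grassmannian_frame [b [bb <-]].
  by rewrite mxtrace_mulC bb mxtrace1.
split=> [G|[xiT xiK trxi]]; first by have [xiT xiK _] := G; split => //; exact: tr_rank.
split => //; have /tr_rank : grassmannian (\rank xi) xi by [].
by rewrite trxi => /eqP; rewrite eqr_nat => /eqP.
Qed.

(** Both frames are completed to orthonormal bases and Q carries one basis to the other. Its
    determinant may be -1, which is repaired in [rotation_coord_rows]. *)
Lemma rotation_exists (m n : nat) (E F : 'M[R]_(m, n)) :
  E *m E^T = 1%:M -> F *m F^T = 1%:M ->
  exists Q : 'M[R]_n, Q *m Q^T = 1%:M /\ E *m Q = F.
Proof.
move=> EE FF.
have mn : (m <= n)%N.
  have := mxrankM_maxl E E^T; rewrite EE mxrank1 => h.
  exact: leq_trans h (rank_leq_col _).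
move: (n - m)%N (subnKC mn) => s ns; subst n => {mn}.
have [E' E'E' E'E] := orthonormal_complete (erefl _ : (m + s = m + s)%N) EE.
have [F' F'F' F'F] := orthonormal_complete (erefl _ : (m + s = m + s)%N) FF.
exists (E^T *m F + E'^T *m F').
have EE' : E *m E'^T = 0 by apply: trmx_inj; rewrite trmx_mul trmxK E'E trmx0.
have FF' : F *m F'^T = 0 by apply: trmx_inj; rewrite trmx_mul trmxK F'F trmx0.
have sumE : E^T *m E + E'^T *m E' = 1%:M.
  by rewrite -mul_row_col -tr_col_mx; apply: mulmx1C; exact: orthonormal_col.
split; last by rewrite mulmxDr !mulmxA EE EE' mul1mx mul0mx addr0.
rewrite linearD /= !trmx_mul !trmxK mulmxDl !mulmxDr.
rewrite !mulmxA -!(mulmxA _ F) -!(mulmxA _ F') FF FF' F'F F'F'.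
by rewrite !mulmx0 !mul0mx !mulmx1 addr0 add0r.
Qed.

End orthonormal.

(** * Volume of the shadows of thin cylinders *)

Section comparison.
Context {R : realType}.

Lemma fine_volumeK (p : nat) (A : set 'rV[R]_p) : compact A ->
  (fine (volume A))%:E = volume A.
Proof. by move=> cA; rewrite fineK // ge0_fin_numE ?volume_ge0 // volume_compact_lty. Qed.

Lemma fine_volume_ge0 (p : nat) (A : set 'rV[R]_p) : 0 <= fine (volume A).
Proof. by rewrite fine_ge0 // volume_ge0. Qed.

Lemma mulmx_coord_le (p q : nat) (x : 'rV[R]_p) (N : 'M[R]_(p, q)) (M e : R) j :
  0 <= M -> (forall i, `|x 0 i| <= M) -> (forall i, `|N i j| <= e) ->
  `|(x *m N) 0 j| <= p%:R * (M * e).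
Proof.
move=> M0 xM Ne; rewrite mxE; apply: le_trans (ler_norm_sum _ _ _) _.
have -> : p%:R * (M * e) = \sum_(i < p) (M * e).
  by rewrite sumr_const card_ord mulr_natl.
by apply: ler_sum => i _; rewrite normrM ler_pM.
Qed.

Lemma thicken_image_mx (p q : nat) (A : set 'rV[R]_p) (N N' : 'M[R]_(p, q))
    (M d rho : R) : 0 <= M -> (forall x, A x -> forall i, `|x 0 i| <= M) ->
  (forall i j, `|N i j - N' i j| <= d) ->
  thicken rho (image_mx A N') `<=` thicken (rho + p%:R * (M * d)) (image_mx A N).
Proof.
move=> M0 AM NN' y [_ [x Ax <-] xy]; exists (x *m N); first by exists x.
move=> j; apply: le_trans (ler_distD ((x *m N') 0 j) _ _) _.
rewrite addrC lerD ?xy //.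
have -> : (x *m N) 0 j - (x *m N') 0 j = (x *m (N - N')) 0 j.
  by rewrite mulmxBr !mxE.
by apply: mulmx_coord_le => // [i|i]; [exact: AM | rewrite !mxE].
Qed.

(** For a fixed D, [volume_usc] provides a radius rho. Half of it absorbs the passage to nearby
    matrices, whose determinants are also close; compactness of the ball of matrices leaves one
    radius for all. *)
Lemma thicken_volume_uniform (d : nat) (S : set 'rV[R]_d) (M eta : R) :
  compact S -> 0 < eta ->
  \forall rho \near (0 : R)^'+, forall D : 'M[R]_d, (forall i j, `|D i j| <= M) ->
    (volume (thicken rho (image_mx S D)) <=
     (`|\det D| * fine (volume S) + eta)%:E)%E.
Proof.
move=> cS eta0; set v := fine (volume S).
have [r r0 Sr] := compact_coord_bound cS.
pose P (rho : R) (D : 'M[R]_d) : Prop := (volume (thicken rho (image_mx S D)) <=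
     (`|\det D| * v + eta)%:E)%E.
suff : \forall rho \near (0 : R)^'+,
      [set D : 'M[R]_d | forall i j, `|D i j| <= M] `<=` P rho.
  by apply: filterS => rho h D DM; exact: h.
move/compact_near_coveringP : (@compact_mx_ball R d d M); apply => D DM.
have eta2 : 0 < eta / 2 by rewrite divr_gt0.
have : (volume (image_mx S D) < (`|\det D| * v + eta / 2)%:E)%E.
  by rewrite volume_mulmx // -(fine_volumeK cS) -EFinM lte_fin ltrDl.
move=> /volume_usc [|rho rho0 vrho]; first exact: compact_image_mulmx.
(* Points of S have coordinates at most r, so changing the entries of D by less than c moves their
   images by at most d r c <= rho / 2. The + 1 keeps the denominator positive when d = 0. *)
pose c := rho / 2 / (d%:R * r + 1).
have dr : 0 < d%:R * r + 1 by rewrite ltr_wpDl // mulr_ge0 // ltW.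
have c0 : 0 < c by rewrite !divr_gt0.
have near_det : \forall D' \near D, `|\det D| * v - `|\det D'| * v < eta / 2.
  have cdet : continuous (fun D' : 'M[R]_d => `|\det D'| * v).
    apply: continuous_mul; last exact: cst_continuous.
    move=> x; apply: (@continuous_comp _ _ _ (fun D' : 'M[R]_d => \det D') (fun y : R => `|y|)).
      by apply: continuous_det => y; exact: cvg_id.
    exact: norm_continuous.
  have /cvgrPdist_lt /(_ _ eta2) := cdet D.
  by apply: filterS => D' /ltr_normlW.
exists ([set D' : 'M[R]_d | (forall i j, `|D i j - D' i j| < c) /\
    `|\det D| * v - `|\det D'| * v < eta / 2], [set rho' | rho' < rho / 2]) => /=.
  split; last by apply: nbhs_right_lt; rewrite divr_gt0.
  by apply: filterI => //; exact: near_coord.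
move=> [D' rho'] /= [[DD' detD'] rho'2].
rewrite /P; apply: (@le_trans _ _ (volume (thicken rho (image_mx S D)))).
  apply: le_volume; apply: subset_trans (thicken_image_mx (N := D) _ _ _) _.
  - exact: ltW r0.
  - by move=> x Sx i; exact: Sr.
  - by move=> i j; apply: ltW; exact: DD'.
  apply: thickenS.
  have : d%:R * (r * c) <= rho / 2.
    rewrite mulrA /c mulrCA ler_piMr ?divr_ge0 ?ltW //.
    by rewrite ltr_pdivrMr // mul1r ltrDl.
  by lra.
apply: le_trans (ltW vrho) _; rewrite lee_fin.
by lra.
Qed.

Definition body (d q : nat) (S : set 'rV[R]_d) (e : R) : set 'rV[R]_(d + q) :=
  [set x | S (lsubmx x) /\ forall i, 0 <= rsubmx x 0 i <= e].

Lemma compact_body (d q : nat) (S : set 'rV[R]_d) (e : R) : compact S ->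
  compact (@body d q S e).
Proof.
move=> cS; have cB := @compact_box R q (fun=> 0) (fun=> e).
have -> : @body d q S e = (fun z => row_mx z.1 z.2) @`
    (S `*` [set x : 'rV[R]_q | forall i, (fun=> 0) i <= x 0 i <= (fun=> e) i]).
  apply/seteqP; split => [x [Sx xe]|_ [[x y] [/= Sx ye] <-]].
    by exists (lsubmx x, rsubmx x); rewrite /= ?hsubmxK.
  by split; rewrite ?row_mxKl ?row_mxKr.
apply: continuous_compact; last exact: compact_setX.
apply: continuous_subspaceT; apply: mx_continuous => i j.
case: (split_ordP j) => k ->.
  under eq_fun do rewrite row_mxEl.
  by apply: continuous_coord => x; exact: cvg_fst.
under eq_fun do rewrite row_mxEr.
by apply: continuous_coord => x; exact: cvg_snd.
Qed.

Lemma volume_orthogonal (p : nat) (A : set 'rV[R]_p) (N : 'M[R]_p) :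
  compact A -> N *m N^T = 1%:M -> volume (image_mx A N) = volume A.
Proof.
move=> cA NN; rewrite volume_mulmx //.
have : \det N ^+ 2 = 1 by rewrite expr2 -{2}det_tr -det_mulmx NN det1.
by move=> /eqP; rewrite sqrf_eq1 => /orP[]/eqP->; rewrite ?normrN normr1 mul1e.
Qed.

(* After a rotation of R^m the map b^T has the block form (0, D; P, Q), so that the
   fiber over w = y P is S *m D, translated by y *m Q = O(e): a loss of order
   eta * e^p only. The bound must be uniform in b, whence thicken_volume_uniform. *)
Lemma body_volume_le (p d q : nat) (S1 S2 : set 'rV[R]_d) (c eta : R) :
  compact S1 -> compact S2 -> 0 < c -> 0 < eta ->
  c * fine (volume S1) <= fine (volume S2) ->
  \forall e \near (0 : R)^'+, forall b : 'M[R]_(p + d, d + q), b *m b^T = 1%:M ->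
    (c%:E * volume (image_mx (@body d q S1 e) b^T) <=
     volume (image_mx (@body d q S2 e) b^T) + (eta * e ^+ p)%:E)%E.
Proof.
move=> cS1 cS2 c0 eta0 cS.
(* The base B of the fibration, the image of the cube under P, lies in a box of sides 2 q e, so its
   volume is at most K e^p; the + 1 keeps K positive when q = 0. With [eta'] the total loss c eta' K
   e^p equals eta e^p. *)
pose K : R := (2 * q%:R + 1) ^+ p.
have K0 : 0 < K by rewrite exprn_gt0 // ltr_wpDl ?mulr_ge0.
pose eta' := eta / (c * K).
have eta'0 : 0 < eta' by rewrite divr_gt0 ?mulr_gt0.
have near_rho := thicken_volume_uniform 1 cS1 eta'0.
have q0 : 0 < q%:R + 1 :> R by rewrite ltr_wpDl.
have near_e : \forall e \near (0 : R)^'+, forall D : 'M[R]_d,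
    (forall i j, `|D i j| <= 1) ->
    (volume (thicken (q%:R * e) (image_mx S1 D)) <=
     (`|\det D| * fine (volume S1) + eta')%:E)%E.
  near (0 : R)^'+ => rho.
  have rho0 : 0 < rho by near: rho; exact: nbhs_right_gt.
  have Prho : forall D : 'M[R]_d, (forall i j, `|D i j| <= 1) ->
    (volume (thicken rho (image_mx S1 D)) <=
     (`|\det D| * fine (volume S1) + eta')%:E)%E by near: rho.
  near=> e => D D1; apply: le_trans (Prho D D1); apply: le_volume; apply: thickenS.
  have e0 : 0 < e by near: e; exact: nbhs_right_gt.
  have : e < rho / (q%:R + 1) by near: e; apply: nbhs_right_lt; rewrite divr_gt0.
  by rewrite ltr_pdivlMr // mulrDr mulr1 => h; rewrite mulrC; lra.
near=> e => b bb.
have e0 : 0 < e by near: e; exact: nbhs_right_gt.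
have Pe : forall D : 'M[R]_d, (forall i j, `|D i j| <= 1) ->
    (volume (thicken (q%:R * e) (image_mx S1 D)) <=
     (`|\det D| * fine (volume S1) + eta')%:E)%E by near: e.
have [N [D [NN ND]]] := orthogonal_reduction (usubmx b^T).
pose T := b^T *m N; pose P := lsubmx (dsubmx T); pose Q := rsubmx (dsubmx T).
have TE : T = block_mx 0 D P Q.
  rewrite -[T]submxK; congr block_mx.
  - by rewrite /ulsubmx /T -mul_usub_mx ND row_mxKl.
  - by rewrite /ursubmx /T -mul_usub_mx ND row_mxKr.
(* T has orthonormal columns, so its entries are at most 1 in modulus, and D stays in the ball of
   the uniform estimate whatever b is. *)
have T1 i j : `|T i j| <= 1.
  have := @orthonormal_entry_le1 _ _ _ T^T j i; rewrite mxE; apply.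
  by rewrite trmxK /T trmx_mul trmxK mulmxA -(mulmxA _ b) bb mulmx1; apply: mulmx1C.
have D1 i j : `|D i j| <= 1.
  by have := T1 (lshift q i) (rshift p j); rewrite TE block_mxEur.
have P1 i j : `|P i j| <= 1.
  by have := T1 (rshift d i) (lshift d j); rewrite TE block_mxEdl.
have Q1 i j : `|Q i j| <= 1.
  by have := T1 (rshift d i) (rshift p j); rewrite TE block_mxEdr.
have cB S : compact S -> compact (image_mx (@body d q S e) T).
  by move=> ?; apply: compact_image_mulmx; exact: compact_body.
have toT S : compact S ->
    volume (image_mx (@body d q S e) b^T) = volume (image_mx (@body d q S e) T).
  move=> cSS; rewrite -[RHS](_ : volume (image_mx (image_mx (@body d q S e) b^T) N) = _).
    by rewrite volume_orthogonal //; apply: compact_image_mulmx; exact: compact_body.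
  by rewrite image_mx_comp.
rewrite !toT //.
pose C := [set x : 'rV[R]_q | forall i, (fun=> 0) i <= x 0 i <= (fun=> e) i].
have cC : compact C by exact: compact_box.
pose B := image_mx C P.
have cBB : compact B by exact: compact_image_mulmx.
have C_le x : C x -> forall i, `|x 0 i| <= e.
  by move=> Cx i; have /andP[x0 xe] := Cx i; rewrite ger0_norm.
have imT (x : 'rV[R]_d) (y : 'rV[R]_q) :
    row_mx x y *m T = row_mx (y *m P) (x *m D + y *m Q).
  by rewrite TE mul_row_block mulmx0 add0r.
have vB : (volume B <= (K * e ^+ p)%:E)%E.
  have BB : B `<=` [set x | forall i : 'I_p,
      (fun=> - (q%:R * e)) i <= x 0 i <= (fun=> q%:R * e) i].
    move=> _ [x Cx <-] i; rewrite -ler_norml -[e]mulr1.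
    by apply: mulmx_coord_le; [exact: ltW | exact: C_le | move=> j; exact: P1].
  apply: le_trans (le_volume BB) _; rewrite volume_box; last first.
    by move=> i; have : 0 <= q%:R * e by [rewrite mulr_ge0 // ltW]; lra.
  rewrite lee_fin prodr_const card_ord /K -exprMn; apply: lerXn2r.
  - by rewrite nnegrE opprK addr_ge0 // mulr_ge0 // ltW.
  - by rewrite nnegrE mulr_ge0 ?addr_ge0 ?mulr_ge0 // ltW.
  by lra.
have up : (volume (image_mx (@body d q S1 e) T) <=
    (`|\det D| * fine (volume S1) + eta')%:E * volume B)%E.
  apply: volume_fiber_le => //; first exact: cB.
  - apply: addr_ge0; last exact: ltW.
    by apply: mulr_ge0 => //; exact: fine_volume_ge0.
  - move=> w; apply: le_trans (Pe D D1); apply: le_volume => u [x [Sx xC]].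
    rewrite -[x]hsubmxK imT => /eq_row_mx[_ uE].
    exists (lsubmx x *m D); first by exists (lsubmx x).
    move=> i; rewrite -uE [X in _ - X]mxE opprD addNKr normrN -[e]mulr1.
    by apply: mulmx_coord_le; [exact: ltW | exact: C_le | move=> j; exact: Q1].
  - move=> w u [x [Sx xC]]; rewrite -[x]hsubmxK imT => /eq_row_mx[wE _].
    by exists (rsubmx x).
have lo : ((`|\det D| * fine (volume S2))%:E * volume B <=
    volume (image_mx (@body d q S2 e) T))%E.
  apply: volume_fiber_ge => //; first exact: cB.
  - by rewrite mulr_ge0 ?fine_volume_ge0.
  - move=> _ [y Cy <-]; rewrite EFinM fine_volumeK // -volume_mulmx //.
    rewrite -(volume_translate (y *m Q)); last exact: compact_image_mulmx.
    apply: le_volume => _ [_ [x Sx <-] <-]; exists (row_mx x y); last exact: imT.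
    by split; rewrite ?row_mxKl ?row_mxKr.
move: up lo; rewrite -(fine_volumeK (cB _ cS1)) -(fine_volumeK (cB _ cS2)).
move: vB; rewrite -(fine_volumeK cBB) -!EFinM -EFinD !lee_fin.
have := fine_volume_ge0 B.
move: (fine (volume B)) => vb vb0 vbK up lo.
apply: le_trans (ler_wpM2l (ltW c0) up) _.
have e1 : c * eta' * vb <= eta * e ^+ p.
  apply: le_trans (ler_wpM2l _ vbK) _; first by rewrite mulr_ge0 ?ltW.
  by rewrite /eta' le_eqVlt; apply/orP; left; apply/eqP; field; rewrite !gt_eqF.
have e2 : c * fine (volume S1) * (`|\det D| * vb) <= fine (volume S2) * (`|\det D| * vb).
  by rewrite ler_wpM2r // mulr_ge0.
by lra.
Unshelve. all: by end_near. Qed.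

End comparison.

(** * Rotation invariant measures on the Grassmannian *)

Section grassmannian_measure.
Context {R : realType}.

Lemma open_measurable_mx (n : nat) (A : set 'M[R]_n) : open A ->
  measurable (A : set (borel_mx R n)).
Proof. by move=> oA; apply: sub_sigma_algebra. Qed.

Lemma closed_measurable_mx (n : nat) (A : set 'M[R]_n) : closed A ->
  measurable (A : set (borel_mx R n)).
Proof.
move=> cA; rewrite -[A]setCK; apply: measurableC.
by apply: open_measurable_mx; exact: closed_openC.
Qed.

Lemma continuous_trmx (n : nat) : continuous (fun A : 'M[R]_n => A^T).
Proof.
by apply: mx_continuous => i j; under eq_fun do rewrite mxE; exact: coord_continuous.
Qed.

Lemma continuous_mxid (n : nat) : continuous (fun A : 'M[R]_n => A).
Proof. by move=> x; exact: cvg_id. Qed.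

Lemma closed_grassmannian (n m : nat) : closed (@grassmannian R n m).
Proof.
have eqmx_closed (f g : 'M[R]_n -> 'M[R]_n) : continuous f -> continuous g ->
    closed [set xi | f xi = g xi].
  move=> cf cg.
  have -> : [set xi | f xi = g xi] =
      \bigcap_(ij in [set: 'I_n * 'I_n]) (fun xi => f xi ij.1 ij.2 - g xi ij.1 ij.2) @^-1` [set 0].
    apply/seteqP; split => [xi fg [i j] _ /=|xi h].
      by rewrite (fg : f xi = g xi) subrr.
    by apply/matrixP => i j; apply/eqP; rewrite -subr_eq0; apply/eqP; exact: (h (i, j) I).
  apply: closed_bigI => -[i j] _; apply: preimage_closed; last exact: closed_eq.
  by move=> x _; apply: continuous_sub; exact: continuous_coord.
have -> : @grassmannian R n m = [set xi | xi^T = xi] `&`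
    ([set xi | xi *m xi = xi] `&` (fun xi : 'M[R]_n => \tr xi) @^-1` [set m%:R]).
  apply/seteqP; split => [xi /grassmannian_trace [? ? ?]//|xi [? [? ?]]].
  exact/grassmannian_trace.
apply: closedI.
  by apply: eqmx_closed; [exact: continuous_trmx | exact: continuous_mxid].
apply: closedI.
  apply: eqmx_closed; last exact: continuous_mxid.
  by apply: continuous_mulmx; exact: continuous_mxid.
apply: preimage_closed; last exact: closed_eq.
move=> x _; apply: continuous_sum => i; exact: coord_continuous.
Qed.

(** For an orthonormal frame b of xi this is det(E b^T)^2, the squared Jacobian of the coordinate
    map b^T on the plane framed by E. Written in terms of xi, it is visibly continuous and free of
    any choice of frame. *)
Definition minor (m n : nat) (E : 'M[R]_(m, n)) (xi : 'M[R]_n) : R :=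
  \det (E *m xi *m E^T).

Lemma continuous_minor (m n : nat) (E : 'M[R]_(m, n)) : continuous (minor E).
Proof.
apply: continuous_det; apply: continuous_mulmx; last exact: cst_continuous.
by apply: continuous_mulmx; [exact: cst_continuous | exact: continuous_mxid].
Qed.

Lemma measurable_minor_neq0 (m n : nat) (E : 'M[R]_(m, n)) :
  measurable ([set xi | minor E xi != 0] : set (borel_mx R n)).
Proof.
apply: open_measurable_mx.
have -> : [set xi | minor E xi != 0] = ~` (minor E @^-1` [set 0]).
  by apply/seteqP; split => xi /= /eqP.
apply: closed_openC; apply: preimage_closed; last exact: closed_eq.
by move=> x _; exact: continuous_minor.
Qed.

Lemma minor_mull (m n : nat) (E : 'M[R]_(m, n)) (D : 'M[R]_m) (xi : 'M[R]_n) :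
  minor (D *m E) xi = \det D ^+ 2 * minor E xi.
Proof.
rewrite /minor trmx_mul !mulmxA det_mulmx -!mulmxA det_mulmx det_tr.
by rewrite !mulmxA mulrC mulrA expr2.
Qed.

Definition coord_rows (m n : nat) (f : 'I_m -> 'I_n) : 'M[R]_(m, n) := rowsub f 1%:M.

Lemma coord_rows_orthonormal (m n : nat) (f : 'I_m -> 'I_n) : injective f ->
  coord_rows f *m (coord_rows f)^T = 1%:M.
Proof.
move=> finj; apply/matrixP => i j; rewrite !mxE (bigD1 (f i)) //= !mxE eqxx mul1r.
rewrite big1 ?addr0 => [|k ki]; last by rewrite !mxE eq_sym (negPf ki) mul0r.
by rewrite eq_sym (inj_eq finj).
Qed.

(** A frame of xi has rank m, so m of its columns are independent; f selects them. *)
Lemma grassmannian_cover (n m : nat) (xi : 'M[R]_n) : grassmannian m xi ->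
  exists2 f : {ffun 'I_m -> 'I_n}, injective f & minor (coord_rows f) xi != 0.
Proof.
move=> /grassmannian_frame [b [bb bxi]].
have full : row_full b^T.
  rewrite /row_full mxrank_tr eqn_leq rank_leq_row /=.
  by have := mxrankM_maxl b b^T; rewrite bb mxrank1.
exists (fullrankfun full); first exact: fullrankfun_inj.
have := fullrowsub_unit full; set f := fullrankfun full.
rewrite unitmxE unitfE => u.
have -> : minor (coord_rows f) xi = \det (rowsub f b^T) ^+ 2.
  rewrite /minor -bxi mulmxA -mulmxA -[b in X in _ *m X]trmxK -trmx_mul.
  have -> : coord_rows f *m b^T = rowsub f b^T by rewrite /coord_rows mul_rowsub_mx mul1mx.
  by rewrite det_mulmx det_tr expr2.
by rewrite expf_neq0.
Qed.

Lemma rotation_coord_rows (m n : nat) (E : 'M[R]_(m, n)) (f : 'I_m -> 'I_n) :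
  (0 < n)%N -> injective f -> E *m E^T = 1%:M ->
  exists Q : 'M[R]_n, [/\ Q^T *m Q = 1%:M, \det Q = 1 &
    exists2 D : 'M[R]_m, \det D != 0 & E *m Q^T = D *m coord_rows f].
Proof.
move=> n0 finj EE.
have [Q [QQ EQ]] := rotation_exists EE (coord_rows_orthonormal finj).
have detQ : \det Q ^+ 2 = 1 by rewrite expr2 -{2}det_tr -det_mulmx QQ det1.
move: detQ => /eqP; rewrite sqrf_eq1 => /orP[] /eqP detQ.
  exists Q^T; split; [by rewrite trmxK | by rewrite det_tr |].
  by exists 1%:M; rewrite ?det1 ?oner_eq0 // mul1mx trmxK.
(* If det Q = -1, flipping the sign of one coordinate corrects it; the flip multiplies the
   coordinate frame by a diagonal matrix of signs, whence the factor D in the statement. *)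
pose c := Ordinal n0.
pose h := \row_(j < n) (if j == c then -1 else 1 : R).
have hh : diag_mx h *m diag_mx h = 1%:M.
  apply/matrixP => i j; rewrite mul_diag_mx !mxE.
  by case: (i == j); case: (i == c); rewrite ?mulr1n ?mulr0n ?mulr0 ?mulr1 ?mulrNN ?mulr1.
exists (Q *m diag_mx h)^T; split.
- rewrite trmxK trmx_mul tr_diag_mx mulmxA -(mulmxA Q) hh mulmx1.
  exact: QQ.
- rewrite det_tr det_mulmx detQ det_diag (bigD1 c) //= mxE eqxx big1 ?mulr1 ?mulrNN ?mulr1 //.
  by move=> j jc; rewrite mxE (negPf jc).
- exists (diag_mx (\row_i h 0 (f i))).
    rewrite det_diag; apply/prodf_neq0 => i _; rewrite !mxE.
    by case: ifP => _; rewrite ?oppr_eq0 oner_eq0.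
  rewrite trmxK mulmxA EQ; apply/matrixP => i j; rewrite mul_mx_diag mul_diag_mx !mxE.
  by case: eqP => [->|_]; rewrite ?mul0r ?mulr0 // mul1r mulr1.
Qed.

(* The Grassmannian is covered by finitely many open sets on which the minor of some
   coordinate m-frame is nonzero, and rotations permute these sets. *)
Lemma rotation_invariant_minor (n m : nat) (mu : probability (borel_mx R n) R)
    (E : 'M[R]_(m, n)) : (0 < n)%N -> rotation_invariant m mu -> E *m E^T = 1%:M ->
  exists (s : R) (A : set (borel_mx R n)),
    [/\ 0 < s, measurable A, A `<=` @grassmannian R n m, (0 < mu A)%E &
        forall xi, A xi -> s <= `|minor E xi|].
Proof.
move=> n0 [muG muQ] EE.
have mG : measurable (@grassmannian R n m : set (borel_mx R n)).
  by apply: closed_measurable_mx; exact: closed_grassmannian.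
pose A j : set (borel_mx R n) :=
  @grassmannian R n m `&` [set xi | j.+1%:R^-1 <= `|minor E xi|].
have mA j : measurable (A j).
  apply: measurableI => //; apply: closed_measurable_mx.
  have -> : [set xi | j.+1%:R^-1 <= `|minor E xi|] =
      (fun xi => `|minor E xi|) @^-1` [set y | j.+1%:R^-1 <= y] by [].
  apply: preimage_closed; last exact: closed_ge.
  move=> x _; apply: (@continuous_comp _ _ _ (minor E) (fun y : R => `|y|)).
    exact: continuous_minor.
  exact: norm_continuous.
have [[j Aj]|nA] := pselect (exists j, (0 < mu (A j))%E).
  by exists j.+1%:R^-1, (A j); split => // xi [].
(* If every [A j] is null, so is the set where [minor E] is nonzero. Its rotations are then null;
   these include the sets of the finite cover, so the Grassmannian would be null although it has
   mass 1. *)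
exfalso.
have A0 j : mu.-negligible (A j).
  apply/negligibleP => //; apply/eqP; rewrite eq_le measure_ge0 andbT leNgt.
  by apply/negP => Aj; apply: nA; exists j.
have GC0 : mu.-negligible (~` (@grassmannian R n m : set (borel_mx R n))).
  apply/negligibleP; first exact: measurableC.
  have := probability_setC mu mG; rewrite muG => h.
  by apply: (etrans h); rewrite subee.
pose U m' (F : 'M[R]_(m', n)) : set (borel_mx R n) := [set xi | minor F xi != 0].
have mU m' (F : 'M[R]_(m', n)) : measurable (U m' F) by exact: measurable_minor_neq0.
have U0 : mu (U _ E) = 0%E.
  apply/negligibleP => //.
  apply: (@negligibleS _ _ _ mu (~` @grassmannian R n m `|` \bigcup_j A j)).
    move=> xi; rewrite /U /= => Exi.
    have [G|] := pselect (grassmannian m xi); last by left.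
    right; have e0 : 0 < `|minor E xi| by rewrite normr_gt0.
    have [j _ /(_ j (leqnn j)) je] := near_infty_natSinv_lt (PosNum e0).
    by exists j => //; split => //=; exact: ltW.
  apply: negligibleU => //; exact: negligible_bigcup.
have G0 : mu.-negligible (@grassmannian R n m : set (borel_mx R n)).
  (* The coordinate frames are enumerated by [pickle] to use countable unions; codes of no function
     and functions that are not injective contribute the empty set. *)
  pose F k := if unpickle k is Some f then
    if injectiveb (f : {ffun 'I_m -> 'I_n}) then U _ (coord_rows f) else set0 else set0.
  apply: (@negligibleS _ _ _ mu (\bigcup_k F k)).
    move=> xi /grassmannian_cover [f finj fxi]; exists (pickle f) => //.
    by rewrite /F pickleK (introT (injectiveP _) finj).
  apply: negligible_bigcup => k; rewrite /F.
  case: unpickle => [f|]; last exact: negligible_set0.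
  case: ifPn => [/injectiveP finj|_]; last exact: negligible_set0.
  have [Q [QQ dQ [D D0 EQ]]] := rotation_coord_rows n0 finj EE.
  apply/negligibleP => //; rewrite -[RHS]U0 -(muQ Q _ QQ dQ (mU _ E)); congr (mu _).
  apply/seteqP; split => xi; rewrite /U /=.
    move=> fxi; have : minor (D *m coord_rows f) xi != 0.
      by rewrite minor_mull mulf_neq0 // expf_neq0.
    by rewrite -EQ /minor trmx_mul trmxK !mulmxA.
  have -> : minor E (Q^T *m xi *m Q) = minor (D *m coord_rows f) xi.
    by rewrite -EQ /minor trmx_mul trmxK !mulmxA.
  by rewrite minor_mull mulf_eq0 negb_or => /andP[].
have : mu (@grassmannian R n m : set (borel_mx R n)) = 0%E by exact/negligibleP.
by rewrite muG => /eqP; rewrite onee_eq0.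
Qed.

End grassmannian_measure.

(** * The shadows of the two bodies *)

Section construction.
Context {R : realType}.

Lemma max_part_conv (x y t : R) : 0 <= t -> t <= 1 ->
  Num.max (t * x + (1 - t) * y) 0 <= t * Num.max x 0 + (1 - t) * Num.max y 0.
Proof.
move=> t0 t1; have t1' : 0 <= 1 - t by lra.
rewrite ge_max addr_ge0 ?mulr_ge0 ?le_max ?lexx ?orbT // andbT.
by apply: lerD; apply: ler_wpM2l => //; rewrite le_max lexx.
Qed.

Lemma cross_conv (d : nat) (a b t : R) (x y : 'rV[R]_d) : 0 <= t -> t <= 1 ->
  cross d a b x -> cross d a b y -> cross d a b (t *: x + (1 - t) *: y).
Proof.
move=> t0 t1 [xa xb] [ya yb]; have t1' : 0 <= 1 - t by lra.
have conv_le (f g : 'I_d -> R) c : \sum_i Num.max (f i) 0 <= c ->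
    \sum_i Num.max (g i) 0 <= c ->
    \sum_i Num.max (t * f i + (1 - t) * g i) 0 <= c.
  move=> fc gc; apply: (@le_trans _ _ (\sum_i (t * Num.max (f i) 0 + (1 - t) * Num.max (g i) 0))).
    by apply: ler_sum => i _; exact: max_part_conv.
  rewrite big_split /= -!mulr_sumr.
  have := ler_wpM2l t0 fc; have := ler_wpM2l t1' gc; lra.
split; first by under eq_bigr do rewrite !mxE; exact: conv_le.
under eq_bigr do rewrite !mxE opprD -!mulrN; exact: conv_le.
Qed.

Lemma convex_body (d q : nat) (a b e : R) :
  convex_set (@body R d q (cross d a b) e : set 'rV[R]_(d + q)).
Proof.
move=> x y t; rewrite !inE => -[Sx xe] [Sy ye].
have t0 : 0 <= t%:num by []. have t1 : t%:num <= 1 by [].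
suff : @body R d q (cross d a b) e (t%:num *: (x : 'rV[R]_(d + q)) +
    (1 - t%:num) *: (y : 'rV[R]_(d + q))) by [].
split.
  rewrite linearD !linearZ /=; exact: cross_conv.
move=> i; rewrite !mxE; move: (xe i) (ye i); rewrite !mxE.
move: t0 t1; move: t%:num => s s0 s1 /andP[x0 x1] /andP[y0 y1].
have s1' : 0 <= 1 - s by lra.
rewrite addr_ge0 ?mulr_ge0 //=.
have := ler_wpM2l s0 x1; have := ler_wpM2l s1' y1; lra.
Qed.

Lemma body_nonempty (d q : nat) (a b e : R) : 0 <= a -> 0 <= b -> 0 <= e ->
  @body R d q (cross d a b) e !=set0.
Proof.
move=> a0 b0 e0; exists 0; split => [|i]; last by rewrite !mxE lexx.
by split; rewrite big1 // => i _; rewrite !mxE ?oppr0 maxxx.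
Qed.

(* Index 0 stands for the origin; mu is an affine dependence between the origin and
   the rows of P, normalized at a coefficient of largest modulus. *)
Lemma affine_dependence (d n : nat) (P : 'M[R]_(d, n)) : (\rank P < d)%N ->
  exists (i0 : 'I_d.+1) (mu : 'I_d.+1 -> R),
    [/\ mu i0 = - 1, forall i, mu i <= 1, \sum_i mu i = 0 &
        \sum_j mu (lift 0 j) *: row j P = 0].
Proof.
move=> rP; pose l' := nz_row (kermx P).
have l'0 : l' != 0 by rewrite nz_row_eq0 -mxrank_eq0 mxrank_ker -lt0n subn_gt0.
have l'P : l' *m P = 0 by apply/sub_kermxP; exact: nz_row_sub.
pose l i := if unlift 0 i is Some j then l' 0 j else - \sum_j l' 0 j.
have l0 : l 0 = - \sum_j l' 0 j by rewrite /l unlift_none.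
have ll j : l (lift 0 j) = l' 0 j by rewrite /l liftK.
pose i0 := [arg max_(i > ord0 : 'I_d.+1) `|l i|]%O.
have i0max i : `|l i| <= `|l i0|.
  by rewrite /i0; case: arg_maxP => // k _ kmax; exact: kmax.
have li0 : l i0 != 0.
  apply: contra l'0 => /eqP li0; apply/eqP/rowP => j; rewrite mxE -ll.
  by apply/eqP; rewrite -normr_eq0 eq_le normr_ge0 andbT (le_trans (i0max _)) ?li0 ?normr0.
exists i0, (fun i => - l i / l i0); split.
- by rewrite mulNr divff.
- move=> i; apply: le_trans (ler_norm _) _.
  by rewrite normrM normrN normfV ler_pdivrMr ?normr_gt0 // mul1r.
- rewrite -mulr_suml big_ord_recl l0 opprK.
  under [X in _ + X]eq_bigr do rewrite ll.
  by rewrite sumrN subrr mul0r.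
- under eq_bigr do rewrite ll mulNr mulrC -mulNr -scalerA.
  by rewrite -scaler_sumr -mulmx_sum_row l'P scaler0.
Qed.

(* The simplex spanned by the origin and the rows of P contains a translate of its
   image under the homothety of ratio -1/k: the center is the barycenter of all
   vertices but the one, i0, of largest coefficient in an affine dependence. *)
Lemma reflected_simplex (k n : nat) (P : 'M[R]_(k.+1, n)) : (0 < k)%N ->
  (\rank P <= k)%N ->
  exists v : 'rV[R]_n, forall s : 'rV[R]_k.+1,
    (forall i, 0 <= s 0 i) -> \sum_i s 0 i <= 1 ->
    exists s' : 'rV[R]_k.+1,
      [/\ forall i, 0 <= s' 0 i, \sum_i s' 0 i <= 1 &
          v - k%:R^-1 *: (s *m P) = s' *m P].
Proof.
move=> k0 rP; have [//|i0 [mu [mui0 mu1 smu muP]]] := @affine_dependence k.+1 n P.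
have kR : 0 < k%:R :> R by rewrite ltr0n.
pose w (i : 'I_k.+2) : R := (i != i0)%:R.
exists (k%:R^-1 *: \sum_j w (lift 0 j) *: row j P) => s s0 s1.
pose sx (i : 'I_k.+2) := if unlift 0 i is Some j then s 0 j else 1 - \sum_j s 0 j.
have sx0 : sx 0 = 1 - \sum_j s 0 j by rewrite /sx unlift_none.
have sxl j : sx (lift 0 j) = s 0 j by rewrite /sx liftK.
have sx_ge0 i : 0 <= sx i.
  by case: (unliftP 0 i) => [j|] ->; rewrite ?sxl ?sx0 ?subr_ge0.
have sum_sx : \sum_i sx i = 1.
  by rewrite big_ord_recl sx0; under [X in _ + X]eq_bigr do rewrite sxl; rewrite subrK.
(* The barycentric coordinates (w - sx) / k of the reflected point sum to 1, but the one at i0 is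
   negative. Adding the multiple - sx i0 of the dependence cancels it, as mu i0 = - 1; the others
   stay nonnegative because mu i <= 1 and sx i + sx i0 <= 1. *)
pose s' (i : 'I_k.+2) := k%:R^-1 * (w i - sx i - sx i0 * mu i).
have sum_s' : \sum_i s' i = 1.
  rewrite -mulr_sumr !big_split /= !sumrN -mulr_sumr smu mulr0 subr0 sum_sx.
  have -> : \sum_i w i = k.+1%:R.
    rewrite (bigD1 i0) //= /w eqxx add0r (eq_bigr (fun=> 1)) => [|i ->//].
    by rewrite sumr_const cardC1 card_ord.
  by rewrite -natr1 addrK mulVf // gt_eqF.
have s'_ge0 i : 0 <= s' i.
  rewrite mulr_ge0 ?invr_ge0 ?(ltW kR) // /w.
  have [->|ii0] := eqVneq i i0; first by rewrite mui0 /=; lra.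
  have : sx i + sx i0 <= 1.
    rewrite -sum_sx (bigD1 i) //= lerD2l (bigD1 i0) 1?eq_sym //= lerDl.
    by apply: sumr_ge0.
  have := ler_wpM2l (sx_ge0 i0) (mu1 i).
  by rewrite mulr1 /=; lra.
exists (\row_j s' (lift 0 j)); split.
- by move=> i; rewrite mxE.
- under eq_bigr do rewrite mxE.
  by rewrite -sum_s' [leRHS]big_ord_recl lerDr.
- rewrite !mulmx_sum_row -scalerBr -sumrB.
  transitivity (\sum_j (s' (lift 0 j) *: row j P)); last first.
    by apply: eq_bigr => j _; rewrite mxE.
  have -> : \sum_j (s' (lift 0 j) *: row j P) =
      k%:R^-1 *: \sum_j ((w (lift 0 j) - s 0 j) *: row j P)
      - (k%:R^-1 * sx i0) *: \sum_j mu (lift 0 j) *: row j P.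
    rewrite !scaler_sumr -sumrB; apply: eq_bigr => j _.
    by rewrite !scalerA -scalerBl; congr (_ *: _); rewrite /s' sxl; ring.
  rewrite muP scaler0 subr0; congr (_ *: _).
  by apply: eq_bigr => j _; rewrite scalerBl.
Qed.

Lemma body_contains_translate (k q : nat) (t e : R) (xi : 'M[R]_(k.+1 + q)) :
  (0 < k)%N -> 0 < t -> t <= 1 -> (\rank xi <= k)%N ->
  contains_translate (shadow (@body R k.+1 q (cross k.+1 1 0) e) xi)
    (shadow (@body R k.+1 q (cross k.+1 (1 - t) (t / k%:R)) e) xi).
Proof.
move=> k0 t0 t1 rxi; pose P := usubmx xi.
have rP : (\rank P <= k)%N.
  apply: leq_trans rxi; rewrite /P.
  have -> : usubmx xi = row_mx 1%:M 0 *m xi.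
    by rewrite -{2}[xi]vsubmxK mul_row_col mul1mx mul0mx addr0.
  exact: mxrankM_maxr.
have [v vP] := reflected_simplex k0 rP.
have kR : 0 < k%:R :> R by rewrite ltr0n.
exists (t *: v) => _ [_ [x [[xa xb] xe] <-] <-].
set y := lsubmx x in xa xb.
pose yp := \row_i Num.max (y 0 i) 0; pose ym := \row_i Num.max (- y 0 i) 0.
have yE : y = yp - ym.
  apply/rowP => i; rewrite [RHS]mxE [yp 0 i]mxE [(- ym) 0 i]mxE [ym 0 i]mxE.
  case/orP: (le_total 0 (y 0 i)) => y0.
    by rewrite (max_l y0) (max_r (_ : - _ <= 0)) ?oppr_le0 // subr0.
  by rewrite (max_r y0) (max_l (_ : 0 <= - _)) ?oppr_ge0 // sub0r opprK.
(* The negative part [ym] lies in (t/k) S, so (k/t) ym lies in S. The reflection, scaled by t,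
   replaces - ym by t s' with s' in S, and yp + t s' belongs to (1 - t) S + t S = S. *)
have [||s' [s'0 s'1 s'P]] := vP ((k%:R / t) *: ym).
- move=> i; rewrite mxE [ym 0 i]mxE; apply: mulr_ge0; last exact: max_part_ge0.
  by rewrite divr_ge0 // ltW.
- under eq_bigr do rewrite mxE [ym _ _]mxE; rewrite -mulr_sumr -ler_pdivlMl ?divr_gt0 //.
  by rewrite mulr1 invf_div.
have yv : y *m P + t *: v = (yp + t *: s') *m P.
  rewrite mulmxDl -scalemxAl -s'P yE mulmxBl scalerBr -scalemxAl !scalerA.
  have -> : t / k%:R * (k%:R / t) = 1 by field; rewrite !gt_eqF.
  by rewrite scale1r addrA addrAC.
exists (row_mx (yp + t *: s') (rsubmx x)); last first.
  rewrite -{2}[x]hsubmxK -/y -[xi]vsubmxK !mul_row_col -/P addrAC yv //.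
split; last by rewrite row_mxKr.
have z_ge0 i : 0 <= (yp + t *: s') 0 i.
  rewrite mxE [yp 0 i]mxE [(t *: s') 0 i]mxE addr_ge0 ?max_part_ge0 //.
  by rewrite mulr_ge0 // ltW.
rewrite row_mxKl; split.
  rewrite (eq_bigr (fun i => yp 0 i + t * s' 0 i)); last first.
    by move=> i _; rewrite max_l // mxE [(t *: s') 0 i]mxE.
  rewrite big_split /= -mulr_sumr.
  have := ler_wpM2l (ltW t0) s'1.
  have : \sum_i yp 0 i <= 1 - t by under eq_bigr do rewrite mxE.
  lra.
by rewrite big1 // => i _; rewrite max_r // oppr_le0.
Qed.

Lemma bernoulli_onem (k : nat) (t : R) : 0 <= t -> t <= 1 ->
  1 - k%:R * t <= (1 - t) ^+ k.
Proof.
move=> t0 t1; elim: k => [|k IH]; first by rewrite mul0r subr0 expr0.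
have t1' : 0 <= 1 - t by lra.
rewrite exprS; apply: le_trans (ler_wpM2l t1' IH).
have : 0 <= k%:R * t * t by rewrite !mulr_ge0.
by rewrite -natr1; lra.
Qed.

Lemma volume_cross_gt (k : nat) : (0 < k)%N ->
  exists2 t : R, 0 < t <= 1 &
    exists2 c : R, 1 < c &
      c * fine (volume (cross k.+1 (1 : R) 0)) <=
      fine (volume (cross k.+1 (1 - t) (t / k%:R))).
Proof.
move=> k0; have kR : 0 < k%:R :> R by rewrite ltr0n.
(* By Bernoulli's inequality the constant c below is at least 1 + t (1 + 1/K - (K^2 + K + 1) t);
   this t leaves 1/K in the parentheses. *)
pose K : R := k%:R; pose t : R := (K ^+ 2 + K + 1)^-1.
have tK : 0 < K ^+ 2 + K + 1 by rewrite !addr_gt0 ?exprn_gt0.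
have t0 : 0 < t by rewrite invr_gt0.
have K1 : 1 <= K by rewrite /K ler1n.
have t1 : t <= 1.
  by rewrite invf_le1 //; have : 0 <= K ^+ 2 by [exact: sqr_ge0]; lra.
exists t; first by rewrite t0 t1.
have t1' : 0 <= 1 - t by lra.
(* The lower bound of [volume_cross_ge] divided by vol S = 1 / (k+1)!. *)
pose c := (1 - t) ^+ k * (1 - t + k.+1%:R ^+ 2 * (t / K)).
exists c.
  have e1 : k.+1%:R ^+ 2 * (t / K) = (K + 2 + K^-1) * t.
    by rewrite -natr1 -/K; field; rewrite gt_eqF.
  have iK : 0 < K^-1 by rewrite invr_gt0.
  have h := bernoulli_onem k (ltW t0) t1.
  have pos : 0 < 1 - t + k.+1%:R ^+ 2 * (t / K).
    by rewrite e1 ltr_wpDl // mulr_gt0 // !addr_gt0.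
  apply: lt_le_trans (ler_wpM2r (ltW pos) h); rewrite e1 -/K.
  have e2 : (1 - K * t) * (1 - t + (K + 2 + K^-1) * t) =
      1 + t * (1 + K^-1 - (K ^+ 2 + K + 1) * t).
    by field; rewrite gt_eqF.
  by rewrite e2 ltrDl mulr_gt0 // /t mulfV ?gt_eqF //; lra.
rewrite -lee_fin fine_volumeK; last exact: compact_cross.
have b0 : 0 <= t / k%:R by rewrite divr_ge0 ?ltW.
apply: le_trans (volume_cross_ge _ t1' b0).
rewrite volume_simplex //= lee_fin /mono_fact expr1n /c factS natrM /= -/K.
have F0 : k`!%:R != 0 :> R by rewrite pnatr_eq0 -lt0n fact_gt0.
have k10 : k.+1%:R != 0 :> R by rewrite pnatr_eq0.
move: (k`!%:R : R) (k.+1%:R : R) F0 k10 => F K' F0 K'0.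
move: (1 - t) (t / K) => s r; rewrite [s ^+ k.+1]exprS.
move: (s ^+ k) => u.
by rewrite le_eqVlt; apply/orP; left; apply/eqP; field; rewrite F0 K'0.
Qed.

End construction.

(** * Intrinsic volumes *)

Section kubota.
Context {R : realType}.

Lemma compact_unit_ball (n : nat) : compact (@unit_ball R n).
Proof.
have cB := @compact_box R n (fun=> - 1) (fun=> 1).
apply: (subclosed_compact _ cB).
  have -> : @unit_ball R n = (fun x : 'rV[R]_n => \sum_i x 0 i ^+ 2) @^-1` [set y | y <= 1] by [].
  apply: preimage_closed; last exact: closed_le.
  move=> x _; apply: continuous_sum => i; apply: continuous_exp; exact: coord_continuous.
move=> x x1 i; rewrite -ler_norml -(@expr_le1 _ 2) // real_normK ?num_real //.
apply: le_trans x1; rewrite (bigD1 i) //= lerDl; apply: sumr_ge0 => j _.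
exact: sqr_ge0.
Qed.

Lemma volume_unit_ball_gt0 (n : nat) : 0 < fine (volume (@unit_ball R n)).
Proof.
(* The cube [0, t]^n fits in the ball, as a sum of n squares at most t is at most 1; the successor
   covers n = 0. *)
pose t : R := n.+1%:R^-1.
have t0 : 0 < t by rewrite invr_gt0.
rewrite -lte_fin fine_volumeK; last exact: compact_unit_ball.
apply: (@lt_le_trans _ _ (volume [set x : 'rV[R]_n | forall i, (fun=> 0) i <= x 0 i <= (fun=> t) i])).
  rewrite volume_box => [|i]; last exact: ltW.
  by rewrite lte_fin prodr_gt0 // => i _; rewrite subr0.
apply: le_volume => x xt; rewrite /unit_ball /=.
apply: (@le_trans _ _ (\sum_(i < n) t)).
  apply: ler_sum => i _; have /andP[x0 x1] := xt i.
  have t1 : t <= 1 by rewrite invf_le1 // ler1n.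
  by rewrite expr2 (le_trans (ler_piMl x0 (le_trans x1 t1))).
by rewrite sumr_const card_ord -mulr_natl ler_pdivrMr // mul1r ler_nat.
Qed.

Lemma flag_coefficient_gt0 (n m : nat) : (m <= n)%N -> 0 < flag_coefficient R n m.
Proof.
move=> mn; rewrite /flag_coefficient /= divr_gt0 ?mulr_gt0 ?volume_unit_ball_gt0 //.
by rewrite ltr0n bin_gt0.
Qed.

(** Since xi = b^T b with b b^T = 1, projecting and then taking coordinates amounts to applying b^T
    alone. *)
Lemma subspace_volume_shadow (n m : nat) (xi : 'M[R]_n) (K : set 'rV[R]_n) :
  grassmannian m xi ->
  subspace_volume m xi (shadow K xi) =
  volume (image_mx K (get (@orthonormal_frame R n m xi))^T).
Proof.
move=> /get_frame; rewrite /subspace_volume; set b := get _ => -[bb bxi].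
congr volume; rewrite /shadow image_mx_comp.
by rewrite -bxi -mulmxA bb mulmx1.
Qed.

(** A frame of the reference plane spanned by the first p axes of the cube followed by the whole
    d-dimensional factor. *)
Definition embedding (p d q : nat) : 'M[R]_(p + d, d + q) :=
  block_mx 0 (pid_mx p) 1%:M 0.

Lemma embedding_orthonormal (p d q : nat) : (p <= q)%N ->
  embedding p d q *m (embedding p d q)^T = 1%:M.
Proof.
move=> pq; rewrite /embedding tr_block_mx mulmx_block !trmx0 trmx1 tr_pid_mx.
rewrite !mul0mx !mulmx0 !mulmx1 !add0r !addr0 mul_pid_mx.
by rewrite minnn (minn_idPr pq) pid_mx_1 -scalar_mx_block.
Qed.

(** In the reference plane the body contains the box [0, e]^p x [0, 1/(d+1)]^d, on which N acts with
    Jacobian |det(embedding N)|. *)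
Lemma body_volume_ge (p d q : nat) (e : R) (N : 'M[R]_(d + q, p + d)) :
  (p <= q)%N -> 0 <= e ->
  ((`|\det (embedding p d q *m N)| * (e ^+ p * d.+1%:R^-1 ^+ d))%:E <=
   volume (image_mx (@body R d q (cross d 1 0) e) N))%E.
Proof.
move=> pq e0; pose t : R := d.+1%:R^-1.
have t0 : 0 <= t by rewrite invr_ge0.
pose s (i : 'I_(p + d)) := if fintype.split i is inl _ then e else t.
have sl i : s (lshift d i) = e by rewrite /s (unsplitK (inl i)).
have sr i : s (rshift p i) = t by rewrite /s (unsplitK (inr i)).
have s0 i : 0 <= s i by rewrite /s; case: fintype.split.
pose B := [set x : 'rV[R]_(p + d) | forall i, (fun=> 0) i <= x 0 i <= s i].
have cB : compact B by exact: compact_box.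
have vB : volume B = (e ^+ p * t ^+ d)%:E.
  rewrite volume_box // big_split_ord /=; congr (_ * _)%:E.
    by under eq_bigr do rewrite sl subr0; rewrite prodr_const card_ord.
  by under eq_bigr do rewrite sr subr0; rewrite prodr_const card_ord.
rewrite EFinM -vB -volume_mulmx //; apply: le_volume => _ [x xB <-].
exists (x *m embedding p d q); last by rewrite mulmxA.
have xE : x *m embedding p d q = row_mx (rsubmx x) (lsubmx x *m pid_mx p).
  by rewrite -{1}[x]hsubmxK mul_row_block mulmx0 mulmx1 add0r mulmx0 addr0.
split; rewrite xE ?row_mxKl ?row_mxKr.
  have xr i : 0 <= rsubmx x 0 i <= t by rewrite mxE -(sr i); exact: xB.
  split.
    apply: (@le_trans _ _ (\sum_(i < d) t)).
      by apply: ler_sum => i _; have /andP[x0 x1] := xr i; rewrite max_l.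
    by rewrite sumr_const card_ord -mulr_natl ler_pdivrMr // mul1r ler_nat.
  rewrite big1 // => i _; have /andP[x0 _] := xr i.
  by rewrite max_r // oppr_le0.
have xl i : 0 <= lsubmx x 0 i <= e by rewrite mxE -(sl i); exact: xB.
move=> j; rewrite mxE; have [jp|jp] := ltnP j p.
  rewrite (bigD1 (Ordinal jp)) //= big1 => [|i ij].
    by rewrite addr0 [pid_mx p _ _]mxE /= eqxx jp mulr1; exact: xl.
  rewrite [pid_mx p _ _]mxE (_ : (i == j :> nat) = false) ?mulr0 //.
  by apply/negbTE; apply: contra ij => /eqP ij; apply/eqP/val_inj.
rewrite big1 ?lexx //= => i _; rewrite [pid_mx p _ _]mxE.
rewrite (_ : (i == j :> nat) = false) ?mulr0 //.
by apply/negbTE; rewrite neq_ltn (leq_trans (ltn_ord i) jp).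
Qed.

(** The bound is uniform in the frame, so the mean over the Grassmannian is finite and real
    arithmetic applies to it. *)
Lemma image_volume_le (p n : nat) (A : set 'rV[R]_n) : compact A ->
  exists2 M : R, 0 <= M & forall b : 'M[R]_(p, n), b *m b^T = 1%:M ->
    (volume (image_mx A b^T) <= M%:E)%E.
Proof.
move=> cA; have [r r0 Ar] := compact_coord_bound cA.
pose s : R := n%:R * (r * 1).
have s0 : 0 <= s by rewrite mulr_ge0 // mulr1 ltW.
exists (\prod_(i < p) (s - - s)).
  by apply: prodr_ge0 => i _; lra.
move=> b bb; rewrite -(@volume_box _ _ (fun=> - s) (fun=> s)) => [|i]; last lra.
apply: le_volume => _ [x Ax <-] i; rewrite -ler_norml.
apply: mulmx_coord_le; [exact: ltW | by move=> j; exact: Ar | move=> j].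
by rewrite mxE; exact: orthonormal_entry_le1.
Qed.

(** With I0 and I1 the two means, c I0 <= I1 + eta e^p and I0 >= delta e^p. If I1 <= I0, then (c -
    1) delta e^p <= eta e^p, which is excluded by taking eta to be half of (c - 1) delta. *)
Lemma body_intrinsic_lt (p k q : nat) (mu : probability (borel_mx R (k.+1 + q)) R)
    (S : set 'rV[R]_k.+1) (c : R) :
  (p <= q)%N -> rotation_invariant (p + k.+1) mu -> compact S -> 1 < c ->
  c * fine (volume (cross k.+1 (1 : R) 0)) <= fine (volume S) ->
  \forall e \near (0 : R)^'+,
    (intrinsic_volume (p + k.+1) mu (@body R k.+1 q (cross k.+1 1 0) e) <
     intrinsic_volume (p + k.+1) mu (@body R k.+1 q S e))%E.
Proof.
move=> pq rmu cS c1 cvol.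
set n := (k.+1 + q)%N; set m := (p + k.+1)%N.
have mn : (m <= n)%N by rewrite /m /n addnC leq_add2l.
have [||s [A [s0 mA AG A0 As]]] := @rotation_invariant_minor _ n m mu (embedding p k.+1 q) _ rmu.
- by rewrite /n addSn.
- exact: embedding_orthonormal.
have muA : mu A = (fine (mu A))%:E.
  rewrite fineK // ge0_fin_numE ?measure_ge0 //.
  by rewrite (le_lt_trans (probability_le1 mu mA)) ?ltry.
pose a := fine (mu A); have a0 : 0 < a by rewrite -lte_fin /a -muA.
pose kappa : R := k.+2%:R^-1 ^+ k.+1.
have kappa0 : 0 < kappa by rewrite exprn_gt0.
(* On A the Jacobian |det(E b^T)| is at least sqrt s, its square being the minor; kappa is the part
   of the box volume that does not depend on e, and a is the mass of A. *)
pose delta := Num.sqrt s * kappa * a.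
have delta0 : 0 < delta by rewrite !mulr_gt0 // sqrtr_gt0.
pose eta := (c - 1) * delta / 2.
have eta0 : 0 < eta by rewrite divr_gt0 // mulr_gt0 // subr_gt0.
have c0 : 0 < c by lra.
have cS0 := @compact_cross R k.+1 1 0.
have near_cmp := @body_volume_le R p k.+1 q _ _ c eta cS0 cS c0 eta0 cvol.
near=> e.
have e0 : 0 < e by near: e; exact: nbhs_right_gt.
have cmp : forall b : 'M[R]_(p + k.+1, k.+1 + q), b *m b^T = 1%:M ->
    (c%:E * volume (image_mx (@body R k.+1 q (cross k.+1 1 0) e) b^T) <=
     volume (image_mx (@body R k.+1 q S e) b^T) + (eta * e ^+ p)%:E)%E by near: e.
have ep0 : 0 < e ^+ p by rewrite exprn_gt0.
rewrite /intrinsic_volume lte_pmul2l //; last by rewrite lte_fin flag_coefficient_gt0.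
pose G := (@grassmannian R n m : set (borel_mx R n)).
have mG : measurable G by apply: closed_measurable_mx; exact: closed_grassmannian.
pose f (T : set 'rV[R]_k.+1) (xi : borel_mx R n) :=
  subspace_volume m xi (shadow (@body R k.+1 q T e) xi).
have fE T xi : G xi -> f T xi =
    volume (image_mx (@body R k.+1 q T e) (get (@orthonormal_frame R n m xi))^T).
  exact: subspace_volume_shadow.
have f0 T xi : G xi -> (0 <= f T xi)%E by move=> Gxi; exact: volume_ge0.
set I0 := (\int[mu]_(xi in G) f (cross k.+1 1 0) xi)%E.
set I1 := (\int[mu]_(xi in G) f S xi)%E.
suff : (I0 < I1)%E by [].
have I0_ge : ((delta * e ^+ p)%:E <= I0)%E.
  pose r := Num.sqrt s * (e ^+ p * kappa).
  have r0 : 0 <= r by rewrite !mulr_ge0 ?sqrtr_ge0 // ltW.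
  have -> : (delta * e ^+ p)%:E = (\int[mu]_(xi in G) (r%:E * (\1_A xi)%:E))%E.
    rewrite ge0_integralZl_EFin //; last by apply/measurable_EFinP; exact: measurable_indic.
    rewrite integral_indic // setIidl // [X in (_ * X)%E](_ : _ = a%:E)%E; last exact: muA.
    by rewrite -EFinM /delta /r; congr EFin; ring.
  apply: le_lower_integral => xi Gxi; first by rewrite -EFinM lee_fin mulr_ge0.
  rewrite indicE; have [Axi|_] := boolP (xi \in A); last by rewrite mule0 f0.
  rewrite mule1 fE //; have [bb bxi] := get_frame Gxi.
  apply: le_trans (body_volume_ge _ pq (ltW e0)).
  rewrite lee_fin; apply: ler_wpM2r; first by rewrite mulr_ge0 // ltW.
  move: bb bxi; set b := get _ => bb bxi; set E := embedding _ _ _.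
  have := As xi; rewrite inE in Axi => /(_ Axi); rewrite /minor -{1}bxi.
  have -> : E *m (b^T *m b) *m E^T = (E *m b^T) *m (E *m b^T)^T.
    by rewrite trmx_mul trmxK !mulmxA.
  rewrite det_mulmx det_tr -expr2 normrX => h.
  by have := ler_wsqrtr h; rewrite sqrtr_sqr normr_id.
have I0_lty : (I0 < +oo)%E.
  have [M M0 fM] := @image_volume_le m n _ (@compact_body R _ q _ e cS0).
  apply: (@le_lt_trans _ _ (\int[mu]_(xi in G) (cst M%:E) xi)%E).
    apply: le_lower_integral => xi Gxi; first exact: f0.
    by rewrite fE //; apply: fM; have [] := get_frame Gxi.
  by rewrite integral_cst //= (rmu.1 : mu G = 1%E) mule1 ltry.
have cI : (c%:E * I0 <= I1 + (eta * e ^+ p)%:E)%E.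
  apply: lower_integral_affine => //.
  - by rewrite mulr_ge0 // ltW.
  - exact: f0.
  - exact: f0.
  - by move=> xi Gxi; rewrite !fE //; apply: cmp; have [] := get_frame Gxi.
have I0_ge0 : (0 <= I0)%E by apply: integral_ge0 => xi; exact: f0.
have I1_ge0 : (0 <= I1)%E by apply: integral_ge0 => xi; exact: f0.
rewrite ltNge; apply/negP => I10.
have I0fin : I0 \is a fin_num by rewrite ge0_fin_numE.
have I1fin : I1 \is a fin_num by rewrite ge0_fin_numE // (le_lt_trans I10).
move: I0_ge cI I10; rewrite -(fineK I0fin) -(fineK I1fin) -EFinM -EFinD !lee_fin.
move: (fine I0) (fine I1) => i0 i1 h0 h1 h2.
have c1' : 0 <= c - 1 by lra.
have := ler_wpM2l c1' h0; rewrite /eta in h1.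
have : 0 < (c - 1) * (delta * e ^+ p) by apply: mulr_gt0; [lra | exact: mulr_gt0].
by lra.
Unshelve. all: by end_near. Qed.

End kubota.

Theorem theorem3p2 (R : realType) (n k : nat)
    (mu : forall m : nat, probability (borel_mx R n) R) :
  (3 <= n)%N -> (1 <= k)%N -> (k < n)%N ->
  (forall m : nat, (m <= n)%N -> rotation_invariant m (mu m)) ->
  exists K L : set 'rV[R]_n,
    [/\ compact_convex K, compact_convex L,
        forall xi : 'M[R]_n, grassmannian k xi ->
          contains_translate (shadow L xi) (shadow K xi)
      & forall m : nat, (k < m <= n)%N ->
          (intrinsic_volume m (mu m) L < intrinsic_volume m (mu m) K)%E].
Proof.
move=> _ k0 kn; move: (n - k.+1)%N (subnKC kn) => q nE; subst n => {kn} rmu.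
have [t /andP[t0 t1] [c c1 cvol]] := @volume_cross_gt R k k0.
have kR : 0 < k%:R :> R by rewrite ltr0n.
have cS := @compact_cross R k.+1 (1 - t) (t / k%:R).
(* The dimensions m = i + (k + 1) with i <= q are finitely many, so a single e serves for all of
   them. *)
have near_lt : \forall e \near (0 : R)^'+, forall i : 'I_q.+1,
    (intrinsic_volume (i + k.+1) (mu (i + k.+1)%N) (@body R k.+1 q (cross k.+1 1 0) e) <
     intrinsic_volume (i + k.+1) (mu (i + k.+1)%N)
       (@body R k.+1 q (cross k.+1 (1 - t) (t / k%:R)) e))%E.
  apply: filter_forall => i; have iq : (i <= q)%N by rewrite -ltnS.
  apply: body_intrinsic_lt cvol => //.
  by apply: rmu; rewrite addnC leq_add2l.
near (0 : R)^'+ => e.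
have e0 : 0 < e by near: e; exact: nbhs_right_gt.
have lt_e : forall i : 'I_q.+1,
    (intrinsic_volume (i + k.+1) (mu (i + k.+1)%N) (@body R k.+1 q (cross k.+1 1 0) e) <
     intrinsic_volume (i + k.+1) (mu (i + k.+1)%N)
       (@body R k.+1 q (cross k.+1 (1 - t) (t / k%:R)) e))%E by near: e.
exists (@body R k.+1 q (cross k.+1 (1 - t) (t / k%:R)) e), (@body R k.+1 q (cross k.+1 1 0) e).
split.
- split; [|exact: compact_body|exact: convex_body].
  by apply: body_nonempty; [rewrite subr_ge0 | rewrite divr_ge0 // ltW | exact: ltW].
- split; [|by apply: compact_body; exact: compact_cross|exact: convex_body].
  by apply: body_nonempty => //; exact: ltW.
- by move=> xi [_ _ rxi]; apply: body_contains_translate; rewrite // rxi.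
- move=> m /andP[km mq].
  have mE : m = (m - k.+1 + k.+1)%N by rewrite subnK.
  have iq : (m - k.+1 < q.+1)%N by rewrite ltnS leq_subLR.
  by rewrite mE; exact: (lt_e (Ordinal iq)).
Unshelve. all: by end_near. Qed.
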